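(* Let $E$ be a Kaplansky–Banach module over a Stone algebra $\mathbb{A}$. Then for $M\subseteq E$ the following assertions are equivalent. (i) $M$ is totally order-bounded. (ii) $M$ is bounded and $\mathrm{mix}(M)$ is relatively cyclically compact in $E$.
   Context: A Stone algebra is a commutative unital $C^*$-algebra $\mathbb{A}$ (unit $\mathbf{1}$) that is Dedekind complete as a Banach lattice; equivalently $\mathbb{A}\cong\mathrm{C}(\Omega)$ with $\Omega$ compact Hausdorff and extremally disconnected. $\mathbb{B}$ is the complete Boolean algebra of idempotents of $\mathbb{A}$ (clopen subsets of $\Omega$), with $p^c=\mathbf{1}-p$. A lattice-normed module over $\mathbb{A}$ is an $\mathbb{A}$-module $E$ (a complex vector space with bilinear multiplication) together with a map $|\cdot|\colon E\to\mathbb{A}_+$ satisfying $|x|=0\Leftrightarrow x=0$, $|x+y|\le|x|+|y|$ and $|\lambda x|=|\lambda||x|$ for $x,y\in E$, $\lambda\in\mathbb{A}$. Its norm is $\|x\|_E=\||x|\|_{\mathbb{A}}$. A net $(x_\alpha)_\alpha$ in $E$ order-converges to $x$ if there is a net $(u_i)_i$ in $\mathbb{A}_+$, decreasing with infimum $0$, such that for each $i$ there is $\alpha_i$ with $|x_\alpha-x|\le u_i$ for all $\alpha\ge\alpha_i$. It is order-Cauchy if $(|x_\alpha-x_\beta|)_{(\alpha,\beta)}$ order-converges to $0$. A Kaplansky–Banach module is a lattice-normed module over a Stone algebra in which every order-Cauchy net order-converges. $M\subseteq E$ is totally order-bounded if there is a net $(u_\alpha)_\alpha$ in $\mathbb{A}_+$,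 decreasing with infimum $0$, such that for every $\alpha$ there is a finite $F\subseteq E$ with $\inf_{y\in F}|x-y|\le u_\alpha$ for every $x\in M$. Mixings. A partition of unity in $\mathbb{B}$ is a family $(p_\alpha)_\alpha$ in $\mathbb{B}$ with $p_\alpha\wedge p_\beta=0$ for $\alpha\ne\beta$ and $\bigvee_\alpha p_\alpha=\mathbf{1}$ (zero elements allowed). An element $x\in E$ is the (unique) mixing of a family $(x_\alpha)_\alpha$ in $E$ over $(p_\alpha)_\alpha$, written $x=\sum_\alpha p_\alpha x_\alpha$, if $p_\alpha|x-x_\alpha|=0$ for all $\alpha$. $\mathrm{mix}(M)$ is the set of all $x\in E$ for which there is a partition of unity $(p_m)_{m\in M}$ with $x=\sum_{m\in M}p_m m$. A set $K\subseteq E$ is mix-complete if every mixing of every family in $K$ over every partition of unity exists and belongs to $K$. Cyclical compactness (Kusraev). For two sequences $\nu,\nu'\colon\mathbb{N}\to\mathbb{B}$ that are partitions of unity write $\nu\ll\nu'$ if $\nu(m)\wedge\nu'(n)\ne0$ implies $m<n$. For a mix-complete set $K$, a sequence $s\colon\mathbb{N}\to K$ and a partition of unity $\nu\colon\mathbb{N}\to\mathbb{B}$, put $s_\nu:=\sum_n\nu(n)s(n)\in K$ (mixing). A cyclic subsequence of $s$ is a sequence $(s_{\nu_k})_{k\in\mathbb{N}}$ where $\nu_k\ll\nu_{k+1}$ for all $k$. $K\subseteq E$ is cyclically compact if it is mix-complete and every sequence in $K$ has a cyclic subsequence converging in norm to an element of $K$. A subset of $E$ is relatively cyclically compact in $E$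 if it is contained in a cyclically compact subset of $E$. The paper works with the following equivalent description, due to Kusraev, which is taken as known: a mix-complete subset $K$ of a Kaplansky–Banach module $E$ is relatively cyclically compact in $E$ if and only if for each real $\varepsilon>0$ there are a countable partition of unity $(q_n)_n$ in $\mathbb{B}$ and a sequence $(F_n)_n$ of finite subsets of $E$ such that for each $x\in K$ and each $n$ there is $z_n\in\mathrm{mix}(F_n)$ with $q_n|x-z_n|\le\varepsilon\mathbf{1}$. *)

(* Defs.v *)
From HB Require Import structures.
From mathcomp Require Import all_boot all_order all_algebra complex.
From mathcomp Require Import all_classical all_reals all_analysis.

Set Implicit Arguments.
Unset Strict Implicit.
Unset Printing Implicit Defensive.

Import Order.TTheory GRing.Theory Num.Theory.
Import numFieldNormedType.Exports.

Local Open Scope classical_set_scope.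
Local Open Scope ring_scope.
Local Open Scope complex_scope.

(* The complex algebra structure is given by its structure morphism: the scalar
   k acts on a as cscalar k * a.  The library's algebra structures would exclude
   the zero algebra, and its normed structures cannot be joined with rings. *)
HB.mixin Record isComCStarAlgebra (R : realType) A of GRing.ComPzRing A := {
  cscalar : {rmorphism R[i] -> A};
  cnorm : A -> R;
  cnorm_eq0 : forall a : A, cnorm a = 0 -> a = 0;
  cnormD : forall a b : A, cnorm (a + b) <= cnorm a + cnorm b;
  cnormZ : forall (k : R[i]) (a : A),
    (cnorm (cscalar k * a))%:C = `|k| * (cnorm a)%:C;
  cnormM : forall a b : A, cnorm (a * b) <= cnorm a * cnorm b;
  cnorm_complete : forall u : nat -> A,
    (forall e : R, 0 < e -> exists N, forall m n,
       (N <= m)%N -> (N <= n)%N -> cnorm (u m - u n) < e) ->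
    exists l : A, (fun n => cnorm (u n - l)) @ \oo --> (0 : R);
  cstar : A -> A;
  cstarK : forall a : A, cstar (cstar a) = a;
  cstarD : forall a b : A, cstar (a + b) = cstar a + cstar b;
  cstarZ : forall (k : R[i]) (a : A),
    cstar (cscalar k * a) = cscalar (Num.conj k) * cstar a;
  cstarM : forall a b : A, cstar (a * b) = cstar b * cstar a;
  cnorm_starM : forall a : A, cnorm (cstar a * a) = cnorm a ^+ 2
}.

#[short(type="comCStarAlgType")]
HB.structure Definition ComCStarAlgebra (R : realType) :=
  {A of GRing.ComPzRing A & isComCStarAlgebra R A}.

Section CStarOrder.
Context {R : realType} {A : comCStarAlgType R}.
Implicit Types (a b p q s : A) (S : set A).

(* Elements comparable to a self-adjoint element are self-adjoint, so bounds
   below need no explicit self-adjointness. *)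
Definition cle a b := exists c : A, b - a = cstar c * c.

Definition is_sup S s :=
  (forall a, S a -> cle a s) /\
  (forall b, (forall a, S a -> cle a b) -> cle s b).

Definition is_inf S s :=
  (forall a, S a -> cle s a) /\
  (forall b, (forall a, S a -> cle b a) -> cle b s).

(* The modulus (a^* a)^(1/2), i.e. the unique positive square root. *)
Definition cmod a : A := xget 0 [set m | cle 0 m /\ m * m = cstar a * a].

(* Boolean algebra of idempotents: the meet of p and q is p * q, the
   complement of p is 1 - p, and p is below q iff p * q = p. *)
Definition idem p := p * p = p.

Definition idem_sup (I : Type) (p : I -> A) s :=
  [/\ idem s,
      forall i, p i * s = p i
    & forall q, idem q -> (forall i, p i * q = p i) -> s * q = s].

Definition partition_of_unity (I : Type) (p : I -> A) :=
  [/\ forall i, idem (p i),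
      forall i j, i <> j -> p i * p j = 0
    & idem_sup p 1].

Definition seq_ll (nu nu' : nat -> A) :=
  forall m n, nu m * nu' n != 0 -> (m < n)%N.

End CStarOrder.

HB.mixin Record isStoneAlgebra (R : realType) A of ComCStarAlgebra R A := {
  dedekind_complete : forall S : set A,
    S !=set0 -> (forall a, S a -> cstar a = a) ->
    (exists u, forall a, S a -> cle a u) ->
    exists s, is_sup S s
}.

#[short(type="stoneAlgType")]
HB.structure Definition StoneAlgebra (R : realType) :=
  {A of ComCStarAlgebra R A & isStoneAlgebra R A}.

(* A unital A-module is a complex vector space through k x = (cscalar k) x, and
   the lattice-norm axioms force unitality and this identity. *)
HB.mixin Record isLatticeNormed (R : realType) (A : stoneAlgType R) E
    of GRing.Lmodule A E := {
  lnorm : E -> A;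
  lnorm_ge0 : forall x : E, cle 0 (lnorm x);
  lnorm_eq0 : forall x : E, lnorm x = 0 <-> x = 0;
  lnormD : forall x y : E, cle (lnorm (x + y)) (lnorm x + lnorm y);
  lnormZ : forall (a : A) (x : E), lnorm (a *: x) = cmod a * lnorm x
}.

#[short(type="latticeNormedModType")]
HB.structure Definition LatticeNormedModule (R : realType)
    (A : stoneAlgType R) := {E of GRing.Lmodule A E & isLatticeNormed R A E}.

Definition directed (I : Type) (le : I -> I -> Prop) :=
  [/\ inhabited I,
      forall i, le i i,
      forall i j k, le i j -> le j k -> le i k
    & forall i j, exists k, le i k /\ le j k].

Definition prod_le (I : Type) (le : I -> I -> Prop) (i j : I * I) :=
  le i.1 j.1 /\ le i.2 j.2.

Section Nets.
Context {R : realType} {A : stoneAlgType R} {E : latticeNormedModType A}.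

Definition decreasing_to0 (I : Type) (le : I -> I -> Prop) (u : I -> A) :=
  [/\ directed le,
      forall i j, le i j -> cle (u j) (u i)
    & is_inf (range u) 0].

(* Order convergence to 0 of a net of positive elements. *)
Definition order_null (I : Type) (le : I -> I -> Prop) (v : I -> A) :=
  exists (J : Type) (leJ : J -> J -> Prop) (u : J -> A),
    decreasing_to0 leJ u /\
    forall j, exists i0, forall i, le i0 i -> cle (v i) (u j).

Definition order_cvg (I : Type) (le : I -> I -> Prop) (x : I -> E) (l : E) :=
  order_null le (fun i => lnorm (x i - l)).

Definition order_cauchy (I : Type) (le : I -> I -> Prop) (x : I -> E) :=
  order_null (prod_le le) (fun ij => lnorm (x ij.1 - x ij.2)).

End Nets.

HB.mixin Record isKaplanskyBanach (R : realType) (A : stoneAlgType R) E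
    of LatticeNormedModule R A E := {
  order_complete : forall (I : Type) (le : I -> I -> Prop) (x : I -> E),
    directed le -> order_cauchy le x -> exists l : E, order_cvg le x l
}.

#[short(type="kaplanskyBanachModType")]
HB.structure Definition KaplanskyBanachModule (R : realType)
    (A : stoneAlgType R) :=
  {E of LatticeNormedModule R A E & isKaplanskyBanach R A E}.

Section LatticeNormedModuleSets.
Context {R : realType} {A : stoneAlgType R} {E : latticeNormedModType A}.
Implicit Types (x y : E) (K M : set E).

Definition enorm x : R := cnorm (lnorm x).

Definition norm_bounded M := exists C : R, forall x, M x -> enorm x <= C.

Definition norm_cvg (t : nat -> E) y :=
  (fun k => enorm (t k - y)) @ \oo --> (0 : R).

(* An empty F has no infimum in a nonzero algebra, so it is only admissible
   for empty M. *)
Definition totally_order_bounded M :=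
  exists (I : Type) (le : I -> I -> Prop) (u : I -> A),
    decreasing_to0 le u /\
    forall i, exists F : set E, finite_set F /\
      forall x, M x ->
        exists g, is_inf [set lnorm (x - y) | y in F] g /\ cle g (u i).

Definition is_mixing (I : Type) (p : I -> A) (x : I -> E) y :=
  forall i, p i * lnorm (y - x i) = 0.

Definition mix M : set E :=
  [set x | exists p : M -> A, partition_of_unity p /\ is_mixing p val x].

Definition mix_complete K :=
  forall (I : Type) (p : I -> A) (x : I -> E),
    partition_of_unity p -> (forall i, K (x i)) ->
    exists y, K y /\ is_mixing p x y.

Definition cyclic_subsequence (s t : nat -> E) :=
  exists nu : nat -> nat -> A,
    [/\ forall k, partition_of_unity (nu k),
        forall k, seq_ll (nu k) (nu k.+1)
      & forall k, is_mixing (nu k) s (t k)].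

Definition cyclically_compact K :=
  mix_complete K /\
  forall s : nat -> E, (forall n, K (s n)) ->
    exists t y, [/\ cyclic_subsequence s t, K y & norm_cvg t y].

Definition relatively_cyclically_compact M :=
  exists K, cyclically_compact K /\ M `<=` K.

End LatticeNormedModuleSets.

(* Main.v *)
Require Import Defs.
From mathcomp Require Import all_boot all_order all_algebra complex.
From mathcomp Require Import all_classical all_reals all_analysis.
From mathcomp Require Import ring lra.

(* Comparisons of self-adjoint elements are decided on idempotents: for all a, b
   there is an idempotent r with b <= a on r and a <= b on 1 - r.  Hence one can
   always argue on arbitrarily small nonzero idempotents, as in a
   Boolean-valued model, and the local choices are glued together along a
   maximal disjoint family, i.e. a partition of unity.  Positivity and square
   roots are obtained without Gelfand theory.

   If M is totally order-bounded, the set K of all points that nowhere violate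
   the covering condition is bounded, norm-closed and mix-complete.  A sequence
   s in K has nested families f_j of idempotents, each meeting every nonzero
   idempotent infinitely often, with s_n within 1/(j+1) of a point y_j on
   f_j(n); choosing first occurrences successively in f_0, f_1, ... yields a
   norm-Cauchy cyclic subsequence.

   Conversely, if M is not totally order-bounded, then on some nonzero r no
   finite set is a d-net for M, and one constructs a sequence in K that is
   d-separated on r; all its cyclic subsequences are then d-separated on r. *)

Set Implicit Arguments.
Unset Strict Implicit.
Unset Printing Implicit Defensive.

Import Order.TTheory GRing.Theory Num.Theory.
Import numFieldNormedType.Exports.

Local Open Scope classical_set_scope.
Local Open Scope ring_scope.
Local Open Scope complex_scope.

Notation rc t := (cscalar t%:C).

Lemma cvg0P (R : realType) (u : nat -> R) : (forall n, 0 <= u n) ->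
  (u @ \oo --> (0 : R)) <->
  forall e : R, 0 < e -> exists N, forall n, (N <= n)%N -> u n < e.
Proof.
move=> u0; split=> [/cvgrPdist_lt h e e0|h].
  have [N _ hN] := h e e0; exists N => n Nn.
  by have := hN n Nn; rewrite /= sub0r normrN ger0_norm.
apply/cvgrPdist_lt => e e0; have [N hN] := h e e0.
exists N => // n Nn /=.
by rewrite sub0r normrN ger0_norm // hN.
Qed.

(** * Norm and involution in a commutative C*-algebra *)

Section CStarAlgebra.
Context {R : realType} {A : comCStarAlgType R}.
Implicit Types (a b c p q : A) (s t : R).

Definition sa a := cstar a = a.

Lemma cnormZr t a : cnorm (rc t * a) = `|t| * cnorm a.
Proof.
have := cnormZ t%:C a; rewrite normc_def /= expr0n addr0 sqrtr_sqr -rmorphM.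
by move/complexI.
Qed.

Lemma cnormN a : cnorm (- a) = cnorm a.
Proof.
have := cnormZr (-1) a; rewrite normrN1 mul1r => <-; congr cnorm.
by rewrite !rmorphN !rmorph1 mulN1r.
Qed.

Lemma cnorm0 : cnorm (0 : A) = 0.
Proof. by have := cnormZr 0 0; rewrite normr0 mul0r mulr0. Qed.

Lemma cnorm_ge0 a : 0 <= cnorm a.
Proof. by have := cnormD a (- a); rewrite subrr cnorm0 cnormN; lra. Qed.

Lemma cnormBC a b : cnorm (a - b) = cnorm (b - a).
Proof. by rewrite -cnormN opprB. Qed.

Lemma cnorm_triangle a b c : cnorm (a - c) <= cnorm (a - b) + cnorm (b - c).
Proof. by have := cnormD (a - b) (b - c); rewrite addrA subrK. Qed.

Lemma cnorm_star a : cnorm (cstar a) = cnorm a.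
Proof.
suff h b : cnorm b <= cnorm (cstar b).
  by apply/eqP; rewrite eq_le h -{2}[a]cstarK h.
have := cnormM (cstar b) b; rewrite cnorm_starM expr2.
have := cnorm_ge0 b; rewrite le_eqVlt => /orP[/eqP <- _|b0].
  exact: cnorm_ge0.
by rewrite ler_pM2r.
Qed.

Lemma cnorm_sqr a : sa a -> cnorm (a * a) = cnorm a ^+ 2.
Proof. by move=> saa; have := cnorm_starM a; rewrite saa. Qed.

Lemma cstar_mul_eq0 a : cstar a * a = 0 -> a = 0.
Proof.
move=> h; have := cnorm_starM a; rewrite h cnorm0 => /esym/eqP.
by rewrite sqrf_eq0 => /eqP /cnorm_eq0.
Qed.

Lemma sqr_eq0 a : sa a -> a * a = 0 -> a = 0.
Proof. by move=> saa h; apply: cstar_mul_eq0; rewrite saa. Qed.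

Lemma cstar1 : cstar (1 : A) = 1.
Proof. by rewrite -[LHS]mulr1 -[X in _ * X]cstarK -cstarM mulr1 cstarK. Qed.

Lemma cstarC (k : R[i]) : cstar (cscalar k : A) = cscalar (Num.conj k).
Proof. by rewrite -[cscalar k]mulr1 cstarZ cstar1 mulr1. Qed.

Lemma cstar_rc t : cstar (rc t : A) = rc t.
Proof. by rewrite cstarC /Num.conj /= oppr0. Qed.

Lemma cstar0 : cstar (0 : A) = 0.
Proof. by have := cstar_rc 0; rewrite !rmorph0. Qed.

Lemma cstarN a : cstar (- a) = - cstar a.
Proof. by apply/eqP; rewrite -addr_eq0 -cstarD addNr cstar0. Qed.

Lemma sa_star a : sa (cstar a * a).
Proof. by rewrite /sa cstarM cstarK. Qed.

Lemma sa_rc t : sa (rc t). Proof. exact: cstar_rc. Qed.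
Lemma sa0 : sa 0. Proof. exact: cstar0. Qed.
Lemma sa1 : sa 1. Proof. exact: cstar1. Qed.
Lemma saN a : sa a -> sa (- a). Proof. by rewrite /sa cstarN => ->. Qed.
Lemma saD a b : sa a -> sa b -> sa (a + b).
Proof. by rewrite /sa cstarD => -> ->. Qed.
Lemma saB a b : sa a -> sa b -> sa (a - b).
Proof. by move=> ? ?; apply/saD/saN. Qed.
Lemma saM a b : sa a -> sa b -> sa (a * b).
Proof. by rewrite /sa cstarM => -> ->; rewrite mulrC. Qed.

(** Only an inequality, since the norm of 1 is 0 in the zero algebra. *)
Lemma cnorm_rc_le t : cnorm (rc t : A) <= `|t|.
Proof.
have := cnormZr t 1; rewrite mulr1 => ->.
have := cnorm_sqr sa1; rewrite mulr1.
have := cnorm_ge0 (1 : A); set x := cnorm _ => x0 h.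
have : x <= 1 by nra.
by move=> ?; rewrite ler_piMr.
Qed.

Lemma rcK t a : t != 0 -> rc t * (rc t^-1 * a) = a.
Proof. by move=> t0; rewrite mulrA -!rmorphM mulfV // !rmorph1 mul1r. Qed.

Lemma rc2 a : rc 2 * a = a + a.
Proof. by rewrite (_ : 2 = 1 + 1 :> R) // !rmorphD !rmorph1 mulrDl mul1r. Qed.

Lemma rc_half t : rc t = rc (t / 2) + rc (t / 2) :> A.
Proof. by rewrite {1}(splitr t) !rmorphD. Qed.

(* The fixed point of z = (y + z^2)/2 is 1 - (1 - y)^(1/2); the iterates for
   y are majorized in norm by those for the number 1. *)
Section SquareRoot.
Variable y : A.

Fixpoint root_iter n : A :=
  if n is m.+1 then rc 2^-1 * (y + root_iter m * root_iter m) else 0.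

Fixpoint root_bound n : R :=
  if n is m.+1 then (1 + root_bound m ^+ 2) / 2 else 0.

Lemma root_bound_itv n : 0 <= root_bound n <= 1.
Proof.
elim: n => [|n /andP[h0 h1]] /=; first by rewrite lexx ler01.
have h : root_bound n ^+ 2 <= 1 by rewrite expr_le1.
have h2 := sqr_ge0 (root_bound n).
by apply/andP; split; lra.
Qed.

Hypothesis y1 : cnorm y <= 1.

Lemma cnorm_root_iter n : cnorm (root_iter n) <= root_bound n.
Proof.
elim: n => [|n IH] /=; first by rewrite cnorm0.
rewrite cnormZr ger0_norm ?invr_ge0 //.
have := cnormD y (root_iter n * root_iter n).
have := cnormM (root_iter n) (root_iter n).
have : cnorm (root_iter n) * cnorm (root_iter n) <= root_bound n ^+ 2.
  by rewrite expr2 ler_pM ?cnorm_ge0.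
by have := y1; lra.
Qed.

(** Differences of squares factor alike for the iterates and for the bounds, so the factors can be
    compared one by one. *)
Lemma root_iterS n :
  cnorm (root_iter n.+1 - root_iter n) <= root_bound n.+1 - root_bound n.
Proof.
elim: n => [|n IH].
  rewrite /= !subr0 mul0r addr0 cnormZr ger0_norm ?invr_ge0 // expr0n /=.
  by have := y1; lra.
have -> : root_iter n.+2 - root_iter n.+1 =
  rc 2^-1 * ((root_iter n.+1 - root_iter n) * (root_iter n.+1 + root_iter n)).
  by rewrite /=; ring.
rewrite cnormZr ger0_norm ?invr_ge0 //.
have h1 := cnormM (root_iter n.+1 - root_iter n) (root_iter n.+1 + root_iter n).
have h2 := cnormD (root_iter n.+1) (root_iter n).
have h3 := cnorm_root_iter n; have h4 := cnorm_root_iter n.+1.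
have h5 := cnorm_ge0 (root_iter n.+1 - root_iter n).
have h6 := cnorm_ge0 (root_iter n.+1 + root_iter n).
have -> : root_bound n.+2 - root_bound n.+1 =
   2^-1 * ((root_bound n.+1 - root_bound n) * (root_bound n.+1 + root_bound n)).
  by rewrite /=; field.
rewrite ler_pM2l ?invr_gt0 //; apply: (le_trans h1); apply: ler_pM => //.
by lra.
Qed.

Lemma root_iter_dist m n : (m <= n)%N ->
  cnorm (root_iter n - root_iter m) <= root_bound n - root_bound m.
Proof.
move=> /subnK <-; elim: (n - m)%N => [|k IH].
  by rewrite add0n !subrr cnorm0.
rewrite addSn; have := root_iterS (k + m).
have := cnorm_triangle (root_iter (k + m).+1) (root_iter (k + m)) (root_iter m).
by lra.
Qed.

Lemma root_bound_cauchy e : 0 < e -> exists N, forall n, (N <= n)%N ->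
  root_bound n - root_bound N < e.
Proof.
move=> e0; have [_ [N _ <-] hN] : exists2 x, range root_bound x &
    sup (range root_bound) - e < x.
  apply: sup_adherent => //; split; first by exists (root_bound 0), 0%N.
  by exists 1 => _ [n _ <-]; case/andP: (root_bound_itv n).
exists N => n _.
have : root_bound n <= sup (range root_bound).
  apply: sup_upper_bound; last by exists n.
  split; first by exists (root_bound 0), 0%N.
  by exists 1 => _ [k _ <-]; case/andP: (root_bound_itv k).
by lra.
Qed.

Lemma exists_root : sa y ->
  exists z, [/\ sa z, cnorm z <= 1 & (1 - z) * (1 - z) = 1 - y].
Proof.
move=> say.
have sai n : sa (root_iter n).
  elim: n => [|n IH] /=; first exact: sa0.
  by apply/saM/saD/saM => //; exact: sa_rc.
have [z hz] : exists z, forall e, 0 < e -> exists N, forall n, (N <= n)%N ->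
    cnorm (root_iter n - z) < e.
  have [|z] := @cnorm_complete _ _ root_iter.
    move=> e e0; have [|N hN] := @root_bound_cauchy (e / 2); first by lra.
    exists N => m n Nm Nn.
    have := cnorm_triangle (root_iter m) (root_iter N) (root_iter n).
    rewrite (cnormBC (root_iter N)).
    have := root_iter_dist Nm; have := root_iter_dist Nn.
    by have := hN m Nm; have := hN n Nn; lra.
  by move/cvg0P => h; exists z; apply: h => n; exact: cnorm_ge0.
have small a C : (forall e, 0 < e -> cnorm a <= C * e) -> a = 0.
  move=> h; apply: cnorm_eq0; apply/eqP; rewrite eq_le cnorm_ge0 andbT.
  have C1 : 0 < `|C| + 1 by have := normr_ge0 C; lra.
  apply/ler_addgt0Pr => e e0; rewrite add0r.
  have := h (e / (`|C| + 1)) (divr_gt0 e0 C1); move/le_trans; apply.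
  rewrite mulrCA ler_piMr ?(ltW e0) // ler_pdivrMr // mul1r.
  by have := ler_norm C; lra.
have z1 : cnorm z <= 1.
  apply/ler_addgt0Pr => e e0; have [N /(_ N (leqnn N)) hN] := hz e e0.
  have := cnorm_triangle z (root_iter N) 0; rewrite !subr0 cnormBC.
  by have := cnorm_root_iter N; case/andP: (root_bound_itv N); lra.
exists z; split => //.
  apply/eqP; rewrite -subr_eq0; apply/eqP; apply: (small _ 2) => e e0.
  have [N /(_ N (leqnn N)) hN] := hz e e0.
  have := cnorm_triangle (cstar z) (root_iter N) z.
  have -> : cstar z - root_iter N = cstar (z - root_iter N).
    by rewrite cstarD cstarN sai.
  by rewrite cnorm_star (cnormBC z (root_iter N)); lra.
suff /eqP : rc 2^-1 * (y + z * z) - z = 0.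
  rewrite subr_eq0 => /eqP h.
  have : rc 2 * (rc 2^-1 * (y + z * z)) = rc 2 * z by rewrite h.
  rewrite rcK ?pnatr_eq0 // rc2 => h2.
  by rewrite -[y](addrK (z * z)) h2; ring.
(* One [e] pays for replacing [z] by an iterate inside the square map, the other for the distance
   from the next iterate to [z]. *)
apply: (small _ 2) => e e0; have [N hN] := hz e e0.
have hN0 := hN N (leqnn N); have hN1 := hN N.+1 (leqnSn N).
have := cnorm_triangle (rc 2^-1 * (y + z * z)) (root_iter N.+1) z.
suff : cnorm (rc 2^-1 * (y + z * z) - root_iter N.+1) <= e by lra.
have -> : rc 2^-1 * (y + z * z) - root_iter N.+1 =
    rc 2^-1 * ((root_iter N - z) * - (root_iter N + z)) by rewrite /=; ring.
rewrite cnormZr ger0_norm ?invr_ge0 //.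
have := cnormM (root_iter N - z) (- (root_iter N + z)); rewrite cnormN.
have := cnormD (root_iter N) z.
have := cnorm_root_iter N; case/andP: (root_bound_itv N).
have := cnorm_ge0 (root_iter N - z); have := cnorm_ge0 (root_iter N + z).
by nra.
Qed.

End SquareRoot.

(** * Positive elements, order and square roots *)

Lemma cle_sub a b : cle a b <-> cle 0 (b - a).
Proof. by rewrite /cle subr0. Qed.

Lemma cle0_star a : cle 0 (cstar a * a).
Proof. by exists a; rewrite subr0. Qed.

Lemma cle0_sqr a : sa a -> cle 0 (a * a).
Proof. by move=> {1}<-; exact: cle0_star. Qed.

Lemma cle0_sa a : cle 0 a -> sa a.
Proof. by case=> c; rewrite subr0 => ->; exact: sa_star. Qed.

(** For [t > 0] the norm of [1 - a / t] is at most 1, so [exists_root] applies to it; its [z] gives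
    [b] as [sqrt t] times [1 - z]. For [t = 0] the hypothesis forces [a = 0]. *)
Lemma cle0_root t a : sa a -> cnorm (rc t - a) <= t ->
  exists b, [/\ sa b, cnorm (rc (Num.sqrt t) - b) <= Num.sqrt t & a = b * b].
Proof.
move=> saa h; have t0 := le_trans (cnorm_ge0 _) h.
move: t0 h; rewrite le_eqVlt => /orP[/eqP <-|t0] h.
  exists 0; split; [exact: sa0|by rewrite sqrtr0 !rmorph0 subrr cnorm0|].
  move: h; rewrite !rmorph0 sub0r cnormN mulr0 => h.
  by apply: cnorm_eq0; apply/eqP; rewrite eq_le h cnorm_ge0.
have tn : t != 0 by rewrite gt_eqF.
have y1 : cnorm (1 - rc t^-1 * a) <= 1.
  have -> : 1 - rc t^-1 * a = rc t^-1 * (rc t - a).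
    by rewrite mulrBr -!rmorphM mulVf // !rmorph1.
  by rewrite cnormZr gtr0_norm ?invr_gt0 // mulrC ler_pdivrMr // mul1r.
have [|z [saz z1 hz]] := exists_root y1.
  by apply/saB/saM => //; [exact: sa1|exact: sa_rc].
exists (rc (Num.sqrt t) * (1 - z)); split.
- by apply/saM/saB => //; [exact: sa_rc|exact: sa1].
- rewrite mulrBr mulr1 subKr cnormZr ger0_norm ?sqrtr_ge0 //.
  by rewrite ler_piMr ?sqrtr_ge0.
- rewrite mulrACA hz -!rmorphM -expr2 sqr_sqrtr ?(ltW t0) //.
  by rewrite subKr rcK.
Qed.

(** Together with its converse [cle0_ex_criterion], this reduces sums of positive elements to the
    triangle inequality. *)
Lemma cle0_criterion t a : sa a -> cnorm (rc t - a) <= t -> cle 0 a.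
Proof.
by move=> saa /(cle0_root saa) [b [sab _ ->]]; exact: cle0_sqr.
Qed.

Lemma cstarI : cstar (cscalar 'i%C : A) = - cscalar 'i%C.
Proof.
rewrite cstarC (_ : Num.conj 'i%C = - 'i%C) ?rmorphN //.
by rewrite /Num.conj /=; congr (_ +i* _); rewrite oppr0.
Qed.

Lemma sqrI : cscalar 'i%C * cscalar 'i%C = -1 :> A.
Proof. by rewrite -rmorphM -expr2 sqr_i rmorphN rmorph1. Qed.

Lemma star_complex a b : sa a -> sa b ->
  cstar (a + cscalar 'i%C * b) * (a + cscalar 'i%C * b) = a * a + b * b.
Proof.
move=> saa sab; rewrite cstarD cstarM cstarI saa sab.
have -> : (a + b * - cscalar 'i%C) * (a + cscalar 'i%C * b) =
  a * a - cscalar 'i%C * cscalar 'i%C * (b * b) by ring.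
by rewrite sqrI mulN1r opprK.
Qed.

(** By the C*-identity [a + i b] has norm at most [t], and [a] is its real part. *)
Lemma cnorm_le_sum_sqr t a b : sa a -> sa b -> 0 <= t -> a * a + b * b = rc (t ^+ 2) ->
  cnorm a <= t.
Proof.
move=> saa sab t0 h.
have hn : cnorm (a + cscalar 'i%C * b) <= t.
  have := cnorm_starM (a + cscalar 'i%C * b); rewrite star_complex // h => e.
  rewrite -(@ler_pXn2r _ 2) ?nnegrE ?cnorm_ge0 // -e.
  by apply: (le_trans (cnorm_rc_le _)); rewrite ger0_norm ?sqr_ge0.
have -> : a = rc 2^-1 * (a + cscalar 'i%C * b + cstar (a + cscalar 'i%C * b)).
  rewrite cstarD cstarM cstarI saa sab mulrN (mulrC b) addrACA subrr addr0.
  by rewrite -rc2 mulrCA rcK.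
rewrite cnormZr ger0_norm ?invr_ge0 //.
have := cnormD (a + cscalar 'i%C * b) (cstar (a + cscalar 'i%C * b)).
by rewrite cnorm_star; lra.
Qed.

(** By [cle0_root] the difference is a square [b^2]; then [a^2 + b^2 = t^2] bounds the norm of [b]
    by [t]. *)
Lemma cnorm_sub_sqr t a : sa a -> cnorm a <= t ->
  cnorm (rc (t ^+ 2) - a * a) <= t ^+ 2.
Proof.
move=> saa at_; have t0 := le_trans (cnorm_ge0 _) at_.
have [||b [sab _ hb]] := @cle0_root (t ^+ 2) (rc (t ^+ 2) - a * a).
- by apply/saB/saM => //; exact: sa_rc.
- rewrite subKr cnorm_sqr //.
  by rewrite ler_pXn2r // nnegrE ?cnorm_ge0.
rewrite hb cnorm_sqr // ler_pXn2r ?nnegrE ?cnorm_ge0 //.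
by apply: (@cnorm_le_sum_sqr _ b a) => //; rewrite -hb subrK.
Qed.

Lemma cle0_ex_criterion a : cle 0 a -> exists2 t, 0 <= t & cnorm (rc t - a) <= t.
Proof.
case=> c; rewrite subr0 => ->.
(* The real and imaginary parts of [c]: by commutativity [c^* c] is the sum of their squares. *)
pose x := rc 2^-1 * (c + cstar c).
pose y := rc 2^-1 * (cscalar 'i%C * (cstar c - c)).
have sax : sa x by rewrite /sa cstarM cstarD cstarK cstar_rc mulrC addrC.
have say : sa y.
  rewrite /sa !cstarM cstarD cstarN cstarK cstar_rc cstarI /y; ring.
have -> : cstar c * c = x * x + y * y.
  have -> : x * x + y * y = rc 2^-1 * rc 2^-1 * ((c + cstar c) * (c + cstar c)
     + (cscalar 'i%C * cscalar 'i%C) * ((cstar c - c) * (cstar c - c))).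
    by rewrite /x /y; ring.
  rewrite sqrI mulN1r.
  have -> : (c + cstar c) * (c + cstar c) - (cstar c - c) * (cstar c - c) =
    rc 2 * (rc 2 * (cstar c * c)) by rewrite !rc2; ring.
  by rewrite -mulrA -!(mulrCA (rc 2)) !rcK.
pose s := cnorm x + cnorm y.
have [x0 y0] := (cnorm_ge0 x, cnorm_ge0 y).
exists (s ^+ 2 + s ^+ 2); first by rewrite addr_ge0 ?sqr_ge0.
have -> : rc (s ^+ 2 + s ^+ 2) - (x * x + y * y) =
   (rc (s ^+ 2) - x * x) + (rc (s ^+ 2) - y * y) by rewrite !rmorphD; ring.
by apply: le_trans (cnormD _ _) (lerD _ _); apply: cnorm_sub_sqr => //;
  rewrite /s; lra.
Qed.

Lemma cle0D a b : cle 0 a -> cle 0 b -> cle 0 (a + b).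
Proof.
move=> pa pb; have [s _ hs] := cle0_ex_criterion pa.
have [t _ ht] := cle0_ex_criterion pb.
apply: (@cle0_criterion (s + t)); first by apply: saD; exact: cle0_sa.
have -> : rc (s + t) - (a + b) = (rc s - a) + (rc t - b) by rewrite !rmorphD; ring.
by apply: le_trans (cnormD _ _) (lerD _ _).
Qed.

Lemma cle0M a b : cle 0 a -> cle 0 b -> cle 0 (a * b).
Proof.
by case=> c; rewrite subr0 => -> [d]; rewrite subr0 => ->; exists (c * d);
  rewrite subr0 cstarM; ring.
Qed.

Lemma cle0_sqrt a : cle 0 a -> exists2 b, cle 0 b & a = b * b.
Proof.
move=> pa; have [t _ ht] := cle0_ex_criterion pa.
have [b [sab hb ->]] := cle0_root (cle0_sa pa) ht.
by exists b => //; apply: (cle0_criterion sab hb).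
Qed.

Lemma cle_norm a : sa a -> cle a (rc (cnorm a)).
Proof.
move=> saa; apply/cle_sub; apply: (@cle0_criterion (cnorm a)).
  by apply/saB => //; exact: sa_rc.
by rewrite subKr.
Qed.

(** With [a = x^2] and [t - a = y^2], [cnorm_le_sum_sqr] bounds the norm of [x] by [sqrt t]. *)
Lemma cnorm_le t a : 0 <= t -> cle 0 a -> cle a (rc t) -> cnorm a <= t.
Proof.
move=> t0 /cle0_sqrt [x /cle0_sa sax ->] /cle_sub /cle0_sqrt [y /cle0_sa say h].
have := @cnorm_le_sum_sqr (Num.sqrt t) x y sax say (sqrtr_ge0 t).
rewrite sqr_sqrtr // -h addrC subrK => /(_ erefl) hx.
rewrite cnorm_sqr // -[leRHS]sqr_sqrtr //.
by rewrite ler_pXn2r // nnegrE ?cnorm_ge0 ?sqrtr_ge0.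
Qed.

Lemma cle_refl a : cle a a.
Proof. by exists 0; rewrite subrr mulr0. Qed.

Lemma cle_trans b a c : cle a b -> cle b c -> cle a c.
Proof.
move=> /cle_sub h1 /cle_sub h2; apply/cle_sub.
by have := cle0D h2 h1; rewrite addrA subrK.
Qed.

Lemma cle_anti a b : cle a b -> cle b a -> a = b.
Proof.
move=> /cle_sub h1 /cle_sub h2; apply/eqP; rewrite eq_sym -subr_eq0.
apply/eqP; apply: cnorm_eq0; apply/eqP; rewrite eq_le cnorm_ge0 andbT.
apply: cnorm_le => //; apply/cle_sub.
by rewrite !rmorph0 sub0r opprB.
Qed.

Lemma cleD a b c d : cle a b -> cle c d -> cle (a + c) (b + d).
Proof.
move=> /cle_sub h1 /cle_sub h2; apply/cle_sub.
by have := cle0D h1 h2; congr cle; ring.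
Qed.

Lemma cleM2l c a b : cle 0 c -> cle a b -> cle (c * a) (c * b).
Proof. by move=> pc /cle_sub h; apply/cle_sub; rewrite -mulrBr; exact: cle0M. Qed.

Lemma cleN a b : cle a b -> cle (- b) (- a).
Proof. by move=> /cle_sub h; apply/cle_sub; rewrite opprK addrC. Qed.

Lemma cle_sub_sa a b : cle a b -> sa (b - a).
Proof. by move/cle_sub/cle0_sa. Qed.

Lemma cle_rc s t : s <= t -> cle (rc s : A) (rc t).
Proof.
move=> st; apply/cle_sub; rewrite -!rmorphB.
have : 0 <= t - s by rewrite subr_ge0.
move: (t - s) => u u0.
apply: (@cle0_criterion u); first exact: sa_rc.
by rewrite subrr cnorm0.
Qed.

Lemma cle0_rc t : 0 <= t -> cle (0 : A) (rc t).
Proof. by move=> /cle_rc; rewrite !rmorph0. Qed.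

Lemma cle01 : cle (0 : A) 1.
Proof. by have := cle0_rc ler01; rewrite !rmorph1. Qed.

(** With [d = a - b], the positive elements [d^2 a] and [d^2 b] have sum [d (a^2 - b^2) = 0], so
    both vanish. Hence [d^3 = 0], and [d = 0] by self-adjointness. *)
Lemma sqrt_unique a b : cle 0 a -> cle 0 b -> a * a = b * b -> a = b.
Proof.
move=> pa pb h; pose d := a - b; have sad : sa d by apply: saB; exact: cle0_sa.
have h0 : d * d * a + d * d * b = 0.
  have -> : d * d * a + d * d * b = d * (a * a - b * b) by rewrite /d; ring.
  by rewrite h subrr mulr0.
have p1 : cle 0 (d * d * a) by apply/cle0M => //; exact: cle0_sqr.
have p2 : cle 0 (d * d * b) by apply/cle0M => //; exact: cle0_sqr.
have e1 : d * d * a = 0.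
  apply: cle_anti => //; rewrite -h0; apply/cle_sub.
  by have := p2; congr cle; ring.
have e2 : d * d * b = 0 by rewrite -h0 e1 add0r.
have e3 : d * d * d = 0 by rewrite {3}/d mulrBr e1 e2 subr0.
suff : d = 0 by move/subr0_eq.
apply: sqr_eq0 => //; apply: sqr_eq0; first exact: saM.
by rewrite mulrA e3 mul0r.
Qed.

Lemma cmodP a : cle 0 (cmod a) /\ cmod a * cmod a = cstar a * a.
Proof.
have [b pb hb] := cle0_sqrt (cle0_star a).
rewrite /cmod; case: xgetP => [x _ //|/(_ b)]; case=> //.
Qed.

Lemma cmod_eq a b : cle 0 b -> b * b = cstar a * a -> cmod a = b.
Proof.
move=> pb hb; have [h1 h2] := cmodP a.
by apply: sqrt_unique => //; rewrite h2.
Qed.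

(** Since [idem] does not ask for self-adjointness, it is derived: [h = p - p^* p] satisfies
    [h^* h = 0], so [p = p^* p]. *)
Lemma idem_sa p : idem p -> sa p.
Proof.
move=> ip; suff h : p - cstar p * p = 0.
  by have := sa_star p; rewrite -(subr0_eq h).
apply: cstar_mul_eq0; rewrite cstarD cstarN cstarM cstarK.
have h : cstar p * cstar p = cstar p by rewrite -cstarM ip.
transitivity (cstar p * p - cstar p * (p * p) - (cstar p * cstar p) * p
   + (cstar p * cstar p) * (p * p)); first by ring.
by rewrite ip h; ring.
Qed.

Lemma idem_ge0 p : idem p -> cle 0 p.
Proof. by move=> ip; rewrite -ip; apply/cle0_sqr/idem_sa. Qed.

Lemma idemC p : idem p -> idem (1 - p).
Proof. by rewrite /idem => ip; rewrite mulrBr mulr1 mulrBl mul1r ip subrr subr0. Qed.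

Lemma idemM p q : idem p -> idem q -> idem (p * q).
Proof. by rewrite /idem => ip iq; rewrite mulrACA ip iq. Qed.

Lemma idem0 : idem (0 : A). Proof. exact: mulr0. Qed.
Lemma idem1 : idem (1 : A). Proof. exact: mulr1. Qed.

Lemma cmod_idem p : idem p -> cmod p = p.
Proof.
move=> ip; apply: cmod_eq; first exact: idem_ge0.
by rewrite (idem_sa ip).
Qed.

Lemma cmodN1 : cmod (-1 : A) = 1.
Proof.
apply: cmod_eq; first exact: cle01.
by rewrite cstarN cstar1 mulrNN.
Qed.

Lemma cle_split p a b : idem p -> cle (p * a) (p * b) ->
  cle ((1 - p) * a) ((1 - p) * b) -> cle a b.
Proof. by move=> ip h1 h2; have := cleD h1 h2; rewrite -!mulrDl subrKC !mul1r. Qed.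

End CStarAlgebra.

(** * Idempotents in a Stone algebra: annihilators, comparison, exhaustion *)

Section StoneAlgebra.
Context {R : realType} {A : stoneAlgType R}.
Implicit Types (a b c d p q r : A) (s t e : R).

Lemma cle_sal a b : sa b -> cle a b -> sa a.
Proof.
by move=> sab /cle_sub_sa h; have := saB sab h; rewrite subKr.
Qed.

Lemma cle_subr_ge0 a b : cle a b -> cle 0 (b - a).
Proof. by move/cle_sub. Qed.

Lemma idem_le1 p : idem p -> cle p 1.
Proof. by move=> /idemC /idem_ge0 ?; apply/cle_sub. Qed.

Lemma cleMp p a b : idem p -> cle a b -> cle (p * a) (p * b).
Proof. by move=> /idem_ge0; exact: cleM2l. Qed.

Lemma idem_mulC p : idem p -> p * (1 - p) = 0.
Proof. by move=> ip; rewrite mulrBr mulr1 ip subrr. Qed.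

Lemma rc_inv_cle1 t a : 0 < t -> cnorm a <= t -> sa a -> cle (rc t^-1 * a) 1.
Proof.
move=> t0 at_ saa; have t0' : 0 <= t^-1 by rewrite invr_ge0 ltW.
have := cleM2l (cle0_rc t0') (cle_trans (cle_norm saa) (cle_rc at_)).
by rewrite -[rc t in X in cle _ X]mulr1 [X in cle _ X]mulrCA rcK ?gt_eqF.
Qed.

(** The idempotent is the supremum [s] of the elements between 0 and 1 that annihilate [a'], a
    rescaling of [a^* a] into that interval. *)
Lemma exists_ann a :
  exists p, [/\ idem p, p * a = 0 & forall b, b * a = 0 -> b * p = b].
Proof.
pose t := cnorm (cstar a * a) + 1.
have t0 : 0 < t by have := cnorm_ge0 (cstar a * a); rewrite /t; lra.
pose a' := rc t^-1 * (cstar a * a).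
have pa' : cle 0 a'.
  by apply: cle0M; [apply: cle0_rc; rewrite invr_ge0 ltW|exact: cle0_star].
have a1 : cle a' 1.
  by apply: rc_inv_cle1 => //; [rewrite /t; lra|exact: sa_star].
pose S := [set b | [/\ cle 0 b, cle b 1 & b * a' = 0]].
have [s [ub lub]] : exists s : A, is_sup S s.
  apply: dedekind_complete.
- by exists 0; split; [exact: cle_refl|exact: cle01|rewrite mul0r].
- by move=> b [/cle0_sa].
- by exists 1 => b [].
have s0 : cle 0 s.
  by apply: ub; split; [exact: cle_refl|exact: cle01|rewrite mul0r].
have s1 : cle s 1 by apply: lub => b [].
have ss : s * a' = 0.
  apply: cle_anti; last exact: cle0M.
  (* Each [b] in [S] equals [b (1 - a')], which lies below [s (1 - a')]. *)
  have : cle s (s * (1 - a')).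
    apply: lub => b [b0 b1 ba]; rewrite -[X in cle X _]subr0 -ba.
    rewrite -[X in X - _]mulr1 -mulrBr !(mulrC _ (1 - a')); apply: cleM2l.
      exact: cle_subr_ge0.
    exact: ub.
  by move/cle_sub => h; apply/cle_sub; move: h; congr cle; ring.
have hS : s * (1 - s) = 0.
  apply: cle_anti; last by apply: cle0M => //; exact: cle_subr_ge0.
  (* The element [s + s (1 - s)] is again in [S], so it cannot exceed [s]. *)
  have /cle_sub h : cle (s + s * (1 - s)) s.
    apply: ub; split.
    - by apply: cle0D => //; apply: cle0M => //; exact: cle_subr_ge0.
    - apply/cle_sub.
      have -> : 1 - (s + s * (1 - s)) = (1 - s) * (1 - s) by ring.
      by apply: cle0M; apply: cle_subr_ge0.
    - by rewrite mulrDl mulrAC ss mul0r addr0.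
  by apply/cle_sub; move: h; congr cle; ring.
have is_ : idem s.
  by rewrite /idem; apply/eqP; rewrite eq_sym -subr_eq0 -hS mulrBr mulr1.
exists s; split => //.
- apply: cstar_mul_eq0; rewrite cstarM (cle0_sa s0).
  have -> : cstar a * s * (s * a) = s * s * (rc t * (rc t^-1 * (cstar a * a))).
    by rewrite rcK ?gt_eqF //; ring.
  by rewrite is_ mulrCA -/a' ss mulr0.
- move=> b ba; pose b' := cstar b * b; pose u := cnorm b' + 1.
  have u0 : 0 < u by have := cnorm_ge0 b'; rewrite /u; lra.
  have pb : cle 0 (rc u^-1 * b').
    by apply: cle0M; [apply: cle0_rc; rewrite invr_ge0 ltW|exact: cle0_star].
  have : cle (rc u^-1 * b') s.
    apply: ub; split => //.
      by apply: rc_inv_cle1 => //; [rewrite /u; lra|exact: sa_star].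
    rewrite /b' /a'.
    transitivity (rc u^-1 * cstar b * rc t^-1 * cstar a * (b * a)); first by ring.
    by rewrite ba mulr0.
  have p1s : cle 0 (1 - s) by exact: cle_subr_ge0.
  move=> /(cleM2l p1s); rewrite [X in cle _ X]mulrC hS => h.
  have h1 : (1 - s) * (rc u^-1 * b') = 0 by apply: cle_anti => //; exact: cle0M.
  have h2 : b * (1 - s) = 0.
    apply: cstar_mul_eq0; rewrite cstarM (cle0_sa p1s).
    have -> : (1 - s) * cstar b * (b * (1 - s)) =
       (1 - s) * ((1 - s) * (rc u * (rc u^-1 * b'))).
      by rewrite rcK ?gt_eqF // /b'; ring.
    by rewrite (mulrCA _ (rc u)) h1 !mulr0.
  by apply/eqP; rewrite eq_sym -subr_eq0 -[X in X - _]mulr1 -mulrBr h2.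
Qed.

(** Let [m] be the absolute value of [d = a - b]. Since the product of [m + d] and [m - d] is 0, the
    annihilating idempotent of [m - d] carries [m + d]: on it [d = m], off it [d = -m]. *)
Lemma comparison a b : sa a -> sa b -> exists r,
  [/\ idem r, cle (r * b) (r * a) & cle ((1 - r) * a) ((1 - r) * b)].
Proof.
move=> saa sab; have sad := saB saa sab; set d := a - b in sad.
have [m pm hm] := cle0_sqrt (cle0_sqr sad).
have [p [ip pd hp]] := exists_ann (m - d).
have h1 : p * d = p * m.
  by apply/eqP; rewrite eq_sym -subr_eq0 -mulrBr pd.
have h2 : (1 - p) * - d = (1 - p) * m.
  have h : (m + d) * p = m + d.
    apply: hp; have -> : (m + d) * (m - d) = m * m - d * d by ring.
    by rewrite hm subrr.
  apply/eqP; rewrite eq_sym -subr_eq0 -mulrBr opprK.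
  rewrite mulrBl mul1r (mulrC p) h ?subrr //.
exists p; split => //; apply/cle_sub; rewrite -mulrBr.
  by rewrite -/d h1; apply: cle0M => //; exact: idem_ge0.
rewrite -(opprB a b) -/d h2; apply: cle0M => //.
exact/idem_ge0/idemC.
Qed.

(** For idempotents this says that the supremum is 1; disjointness is left out, because it is also
    applied to overlapping families. *)
Definition covering (I : Type) (p : I -> A) :=
  forall r, idem r -> (forall i, r * p i = 0) -> r = 0.

Lemma partition_of_unityP (I : Type) (p : I -> A) : partition_of_unity p <->
  [/\ forall i, idem (p i), forall i j, i <> j -> p i * p j = 0 & covering p].
Proof.
split=> [[ip dp [_ _ h]]|[ip dp h]]; split => //.
- move=> r ir hr; have := h (1 - r) (idemC ir).
  rewrite mul1r => e; suff : 1 - r = 1.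
    by move/eqP; rewrite subr_eq addrC -subr_eq subrr eq_sym => /eqP.
  by apply: e => i; rewrite mulrBr mulr1 mulrC hr subr0.
- split=> [|i|q iq hq]; first exact: mulr1; first by rewrite mulr1.
  rewrite mul1r; apply/eqP; rewrite eq_sym -subr_eq0; apply/eqP.
  by apply: h => [|i]; [exact: idemC|rewrite mulrBl mul1r mulrC hq subrr].
Qed.

Lemma covering_eq0 (I : Type) (p : I -> A) d : covering p ->
  (forall i, p i * d = 0) -> d = 0.
Proof.
move=> dp h; have [q [iq qd hq]] := exists_ann d.
have : 1 - q = 0.
  apply: dp => [|i]; first exact: idemC.
  by rewrite mulrBl mul1r mulrC hq ?subrr.
by move/eqP; rewrite subr_eq0 => /eqP q1; move: qd; rewrite -q1 mul1r.
Qed.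

Lemma cle_by_parts r a b : idem r -> r * (a - b) = 0 ->
  cle ((1 - r) * a) ((1 - r) * b) -> cle a b.
Proof.
move=> ir h1; apply: (cle_split ir).
by rewrite (_ : r * a = r * b); [exact: cle_refl|apply/subr0_eq; rewrite -mulrBr].
Qed.

Lemma covering_cle (I : Type) (p : I -> A) a b : sa a -> sa b -> covering p ->
  (forall i, idem (p i)) -> (forall i, cle (p i * a) (p i * b)) -> cle a b.
Proof.
move=> saa sab dp ip h; have [r [ir h1 h2]] := comparison saa sab.
apply: (cle_by_parts ir) => //; apply: (covering_eq0 dp) => i.
apply: cle_anti.
  have /(cleMp ir)/cle_sub hi := h i; apply/cle_sub.
  by move: hi; congr cle; ring.
have /cle_sub hi := cleMp (ip i) h1.
by move: hi; congr cle; ring.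
Qed.

Lemma cle_forcing a b : sa a -> sa b ->
  (forall r, idem r -> cle (r * b) (r * a) -> r = 0) -> cle a b.
Proof.
move=> saa sab h; have [r [ir h1 h2]] := comparison saa sab.
by apply: (cle_by_parts ir) => //; rewrite (h r) // mul0r.
Qed.

Lemma cle_eps a b : sa a -> sa b ->
  (forall e, 0 < e -> cle a (b + rc e)) -> cle a b.
Proof.
move=> saa sab h; have [r [ir h1 h2]] := comparison saa sab.
apply: (cle_by_parts ir) => //; apply: cnorm_eq0; apply/eqP.
rewrite eq_le cnorm_ge0 andbT; apply/ler_addgt0Pr => e e0; rewrite add0r.
apply: cnorm_le; first exact: ltW.
  by have /cle_sub := h1; rewrite -mulrBr.
apply: (@cle_trans _ _ (r * rc e)).
  apply: cleMp => //; have /cle_sub := h e e0 => hh; apply/cle_sub.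
  by move: hh; congr cle; ring.
have /cle_sub := cleM2l (cle0_rc (ltW e0)) (idem_le1 ir) => hh; apply/cle_sub.
by move: hh; congr cle; ring.
Qed.

Lemma exists_inf (S : set A) : S !=set0 -> (forall a, S a -> cle 0 a) ->
  exists g, is_inf S g.
Proof.
move=> [a0 Sa0] S0.
have [s [ub lub]] : exists s : A, is_sup [set - a | a in S] s.
  apply: dedekind_complete; first by exists (- a0), a0.
    by move=> _ [a Sa <-]; exact/saN/cle0_sa/S0.
  by exists 0 => _ [a /S0 a_ge0 <-]; have := cleN a_ge0; rewrite oppr0.
exists (- s); split=> [a Sa|b hb].
  by rewrite -[a]opprK; apply/cleN/ub; exists a.
rewrite -[b]opprK; apply/cleN/lub => _ [a Sa <-].
exact/cleN/hb.
Qed.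

Lemma exists_min a b : sa a -> sa b -> exists m,
  [/\ cle m a, cle m b & forall c, cle c a -> cle c b -> cle c m].
Proof.
move=> saa sab; have [r [ir h1 h2]] := comparison saa sab.
pose m := r * b + (1 - r) * a.
have rm : r * m = r * b by rewrite mulrDr !mulrA ir idem_mulC // mul0r addr0.
have rm' : (1 - r) * m = (1 - r) * a.
  by rewrite mulrDr !mulrA (idemC ir) (mulrC _ r) idem_mulC // mul0r add0r.
exists m; split=> [||c ca cb]; apply: (cle_split ir); rewrite ?rm ?rm' //.
- exact: cle_refl.
- exact: cle_refl.
- exact: cleMp.
- by apply: cleMp => //; exact: idemC.
Qed.

Lemma idem_rc_eq0 r s t : t < s -> idem r -> cle (r * rc s) (r * rc t) -> r = 0.
Proof.
move=> ts ir h.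
have e : r * rc (s - t) = 0.
  apply: cle_anti.
    have /cle_sub hh := h; apply/cle_sub; move: hh; congr cle.
    by rewrite !rmorphB; ring.
  by apply: cle0M; [exact: idem_ge0|apply: cle0_rc; lra].
have st : s - t != 0 by lra.
by rewrite -[r](@rcK _ _ _ _ st) mulrCA (mulrC _ r) e mulr0.
Qed.

(** Zorn's lemma gives a maximal disjoint family in [D], indexed by its own members. A nonzero
    idempotent disjoint from all of them would contain a further member of [D], against
    maximality. *)
Lemma exhaustion (D : set A) : (forall p, D p -> idem p) ->
  (forall r, idem r -> r <> 0 -> exists q, [/\ D q, q <> 0 & q * r = q]) ->
  exists (I : Type) (p : I -> A), partition_of_unity p /\ forall i, D (p i).
Proof.
move=> Did Dd.
pose P := [set X : set A | X `<=` D /\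
  forall p q, X p -> X q -> p <> q -> p * q = 0].
have [F FP Ft|X [[XD Xo] Xmax]] := @Zorn_bigcup A P.
  split=> [p [X /FP [XD _] /XD]|p q [X FX Xp] [Y FY Yq]] //.
  have [XY|YX] := Ft _ _ FX FY.
    by have [_] := FP _ FY; apply => //; exact: XY.
  by have [_] := FP _ FX; apply => //; exact: YX.
exists {q : A | X q}, (@proj1_sig _ _); split; last by case=> q /= /XD.
apply/partition_of_unityP; split=> [[q /= /XD/Did]|[q Xq] [q' Xq'] /= ne|] //.
  by apply: Xo => // e; apply: ne; exact: eq_exist.
move=> r ir hr; apply: contrapT => r0.
have [q [Dq q0 qr]] := Dd r ir r0.
have qX p : X p -> q * p = 0.
  by move=> Xp; rewrite -qr -mulrA (hr (exist _ p Xp)) mulr0.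
apply: (Xmax (X `|` [set q])).
  split=> [p|h]; first by left.
  have Xq : X q by apply: h; right.
  by apply: q0; have := qX _ Xq; rewrite (Did _ Dq).
split=> [p [/XD|->]|p p' [Xp|->] [Xp'|->]] //.
- exact: Xo.
- by rewrite mulrC qX.
- by rewrite qX.
Qed.

End StoneAlgebra.

(** * Rules for the lattice norm *)

Section LatticeNormedModule.
Context {R : realType} {A : stoneAlgType R} {E : latticeNormedModType A}.
Implicit Types (a b c p q r : A) (s t e : R) (x y z : E).

Lemma sa_lnorm x : sa (lnorm x).
Proof. exact/cle0_sa/lnorm_ge0. Qed.

Lemma lnormN x : lnorm (- x) = lnorm x.
Proof. by rewrite -scaleN1r lnormZ cmodN1 mul1r. Qed.

Lemma lnormBC x y : lnorm (x - y) = lnorm (y - x).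
Proof. by rewrite -lnormN opprB. Qed.

Lemma lnorm0 : lnorm (0 : E) = 0.
Proof. exact/lnorm_eq0. Qed.

Lemma lnorm_idem p x : idem p -> lnorm (p *: x) = p * lnorm x.
Proof. by move=> ip; rewrite lnormZ cmod_idem. Qed.

Lemma lnorm_triangle y x z : cle (lnorm (x - z)) (lnorm (x - y) + lnorm (y - z)).
Proof. by have := lnormD (x - y) (y - z); rewrite addrA subrK. Qed.

Lemma lnorm_le_add x y : cle (lnorm x) (lnorm y + lnorm (x - y)).
Proof. by have := lnormD y (x - y); rewrite subrKC. Qed.

Lemma mul_lnorm_eq0 p x y : idem p ->
  p * lnorm (x - y) = 0 <-> p *: x = p *: y.
Proof.
move=> ip; rewrite -lnorm_idem // scalerBr; split=> [/lnorm_eq0/subr0_eq //|->].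
by rewrite subrr lnorm0.
Qed.

Lemma lnorm_sub_on p x y z : idem p -> p *: x = p *: y ->
  p * lnorm (x - z) = p * lnorm (y - z).
Proof. by move=> ip h; rewrite -!lnorm_idem // !scalerBr h. Qed.

Lemma cle_enorm x : cle (lnorm x) (rc (enorm x)).
Proof. exact/cle_norm/sa_lnorm. Qed.

Lemma enorm_le x t : 0 <= t -> cle (lnorm x) (rc t) -> enorm x <= t.
Proof. by move=> t0; apply: cnorm_le => //; exact: lnorm_ge0. Qed.

Lemma norm_boundedP (M : set E) : norm_bounded M <->
  exists2 C, 0 <= C & forall x, M x -> cle (lnorm x) (rc C).
Proof.
split=> [[C hC]|[C C0 hC]]; last by exists C => x Mx; exact: enorm_le (hC x Mx).
exists `|C| => // x Mx; apply: cle_trans (cle_enorm x) _; apply: cle_rc.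
by apply: le_trans (hC x Mx) _; exact: ler_norm.
Qed.

End LatticeNormedModule.

(** * Mixings and norm completeness *)

Section KaplanskyBanach.
Context {R : realType} {A : stoneAlgType R} {E : kaplanskyBanachModType A}.
Implicit Types (a b c p q r : A) (s t e : R) (x y z : E).

Lemma is_mixingP (I : Type) (p : I -> A) (x : I -> E) y : (forall i, idem (p i)) ->
  is_mixing p x y <-> forall i, p i *: y = p i *: x i.
Proof. by move=> ip; split=> h i; have := h i; move/(mul_lnorm_eq0 _ _ (ip i)). Qed.

(* Partial mixings (q, z), where z is supported on q and agrees there with the
   prescribed family, are directed by the support; this net is order-Cauchy
   because two members agree on the smaller support. *)
Lemma exists_mixing (I : Type) (p : I -> A) (x : I -> E) c :
  partition_of_unity p -> (forall i, cle (p i * lnorm (x i)) c) -> cle 0 c ->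
  exists y, is_mixing p x y.
Proof.
move=> /partition_of_unityP [ip op dp] hc c0.
have sac := cle0_sa c0.
pose T := {u : A * E | [/\ idem u.1, u.1 *: u.2 = u.2, cle (lnorm u.2) c &
  forall i, (u.1 * p i) *: u.2 = (u.1 * p i) *: x i]}.
pose supp (u : T) := (proj1_sig u).1; pose elt (u : T) := (proj1_sig u).2.
pose le (u v : T) := supp u * supp v = supp u.
have isupp u : idem (supp u) by case: u => ? [].
have esupp u : supp u *: elt u = elt u by case: u => ? [].
have leu u : cle (lnorm (elt u)) c by case: u => ? [].
have helt u i : (supp u * p i) *: elt u = (supp u * p i) *: x i by case: u => ? [].
have agree u v : le u v -> supp u *: elt u = supp u *: elt v.
  move=> uv; apply/(mul_lnorm_eq0 _ _ (isupp u)); apply: (covering_eq0 dp) => i.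
  have iw := idemM (isupp u) (ip i).
  rewrite mulrA (mulrC (p i)); apply/(mul_lnorm_eq0 _ _ iw).
  by rewrite helt -uv -mulrA -!scalerA !(scalerA (supp v)) helt.
have [atom hatom] : exists a : I -> T, forall i, supp (a i) = p i /\
    elt (a i) = p i *: x i.
  suff h i : [/\ idem (p i), p i *: (p i *: x i) = p i *: x i,
      cle (lnorm (p i *: x i)) c &
      forall j, (p i * p j) *: (p i *: x i) = (p i * p j) *: x j].
    by exists (fun i => exist _ (p i, p i *: x i) (h i)).
  split=> // [||j]; [by rewrite scalerA ip|by rewrite lnorm_idem|].
  have [<-|ij] := pselect (i = j); first by rewrite scalerA -mulrA ip ip.
  by rewrite op // !scale0r.
have dir : directed le.
  split.
  - suff h : [/\ idem (0 : A), (0 : A) *: (0 : E) = 0, cle (lnorm (0 : E)) c &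
        forall i, (0 * p i) *: (0 : E) = (0 * p i) *: x i].
      exact: (inhabits (exist _ (0, 0) h)).
    split; [exact: idem0|exact: scaler0|by rewrite lnorm0|].
    by move=> i; rewrite mul0r !scale0r.
  - by move=> u; exact: isupp.
  - by move=> u v w uv vw; rewrite /le -uv -mulrA vw.
  - move=> u v; set a := supp u; set b := supp v.
    have [ia ib] : idem a /\ idem b by split; exact: isupp.
    (* The join of the two supports; [z] is [elt u] on [a] and [elt v] off [a]. *)
    pose q := 1 - (1 - a) * (1 - b); pose z := elt u + (1 - a) *: elt v.
    have aq : a * q = a by rewrite /q mulrBr mulr1 mulrA idem_mulC // mul0r subr0.
    have bq : b * q = b.
      by rewrite /q mulrBr mulr1 mulrCA idem_mulC // mulr0 subr0.
    have iq : idem q by apply/idemC/idemM; exact: idemC.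
    have az : a *: z = a *: elt u.
      by rewrite scalerDr scalerA idem_mulC // scale0r addr0.
    have cz : (1 - a) *: z = (1 - a) *: elt v.
      rewrite scalerDr scalerA (idemC ia) -[elt u]esupp scalerA mulrC.
      by rewrite idem_mulC // scale0r add0r.
    have h : [/\ idem q, q *: z = z, cle (lnorm z) c &
        forall i, (q * p i) *: z = (q * p i) *: x i].
      split=> // [||i].
      + have qv : q *: elt v = elt v by rewrite -[elt v]esupp scalerA mulrC bq.
        rewrite scalerDr scalerA (mulrC q) -scalerA qv; congr (_ + _).
        by rewrite -[elt u]esupp scalerA mulrC aq.
      + apply: (cle_split ia).
          by rewrite -lnorm_idem // az lnorm_idem //; apply: cleMp.
        have ica := idemC ia.
        by rewrite -lnorm_idem // cz lnorm_idem //; apply: cleMp.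
      + have -> : q * p i = p i * a + (b * p i) * (1 - a) by rewrite /q; ring.
        rewrite !scalerDl -!(scalerA _ a) -!(scalerA _ (1 - a)) az cz.
        rewrite !(scalerA (p i)) (mulrC (p i)) helt; congr (_ + _).
        by rewrite !scalerA !(mulrC _ (1 - a)) -!(scalerA (1 - a)) helt.
    by exists (exist _ (q, z) h).
(* Off a common smaller support, two members differ by at most [2 c]. *)
pose f (u : T) := (1 - supp u) * (c + c).
have f0 : decreasing_to0 le f.
  have cc0 : cle 0 (c + c) by exact: cle0D.
  split=> // [u v uv|].
    have /cle_subr_ge0 h : cle (supp u) (supp v).
      apply/cle_sub.
      have -> : supp v - supp u = supp v * (1 - supp u).
        by rewrite mulrBr mulr1 mulrC uv.
      by apply: cle0M; apply: idem_ge0 => //; exact: idemC.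
    apply/cle_sub; have := cle0M h cc0; congr cle; rewrite /f; ring.
  split=> [_ [u _ <-]|b hb].
    by apply: cle0M => //; apply/idem_ge0/idemC.
  have hi i : cle b ((1 - p i) * (c + c)).
    by have [<- _] := hatom i; apply: hb; exists (atom i).
  have [[u _ _ _]] := dir.
  have sab : sa b.
    apply: cle_sal (hb (f u) _); last by exists u.
    by apply/cle0_sa/cle0M => //; apply/idem_ge0/idemC.
  apply: (covering_cle sab sa0 dp) => // i.
  have := cleMp (ip i) (hi i).
  by rewrite mulrA idem_mulC // mul0r mulr0.
have cau : order_cauchy le elt.
  exists T, le, f; split=> // w; exists (w, w) => -[u v] [/= wu wv].
  apply: (cle_split (isupp w)).
    have := agree _ _ wu; rewrite (agree _ _ wv) => /esym.
    move/(mul_lnorm_eq0 _ _ (isupp w)) => ->.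
    by rewrite /f mulrA idem_mulC // mul0r; exact: cle_refl.
  have icw := idemC (isupp w).
  rewrite /f mulrA icw; apply: cleMp => //.
  apply: cle_trans (lnormD _ _) _; rewrite lnormN.
  exact: cleD.
have [l [J [leJ [g [[_ _ [g0 ginf]] hl]]]]] := order_complete _ _ _ dir cau.
exists l => i; have [s1 e1] := hatom i.
apply: cle_anti; last by apply: cle0M; [exact: idem_ge0|exact: lnorm_ge0].
apply: ginf => _ [j _ <-].
have [i0 hi0] := hl j; have [_ _ _ /(_ i0 (atom i)) [k [k0 ki]]] := dir.
have := agree _ _ ki; rewrite s1 e1 scalerA ip => hk.
rewrite lnormBC (lnorm_sub_on _ (ip i) hk).
apply: cle_trans (cleMp (ip i) (hi0 _ k0)) _.
have /(cleM2l (g0 _ _)) := idem_le1 (ip i).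
by move=> /(_ (g j)); rewrite mulr1 mulrC; apply; exists j.
Qed.

Definition norm_limit (x : nat -> E) l := forall e, 0 < e ->
  exists N, forall n, (N <= n)%N -> cle (lnorm (x n - l)) (rc e).

Lemma norm_cvgP (x : nat -> E) l : norm_cvg x l <-> norm_limit x l.
Proof.
rewrite /norm_cvg cvg0P => [|n]; last exact: cnorm_ge0.
split=> h e e0.
  have [N hN] := h e e0; exists N => n /hN /ltW /(@cle_rc _ A).
  by apply: cle_trans; exact: cle_enorm.
have [|N hN] := h (e / 2); first by lra.
by exists N => n /hN /enorm_le h1; apply: le_lt_trans (h1 _) _; lra.
Qed.

(** The positive constants decrease to 0, so a norm-Cauchy sequence is order-Cauchy; the order limit
    is then seen to be a norm limit. *)
Lemma norm_complete (x : nat -> E) :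
  (forall e, 0 < e -> exists N, forall m n, (N <= m)%N -> (N <= n)%N ->
    cle (lnorm (x m - x n)) (rc e)) ->
  exists l, norm_limit x l.
Proof.
move=> hx.
have dir : directed (fun m n => (m <= n)%N : Prop).
  split; [exact: (inhabits 0%N)|by []|by move=> i j k; exact: leq_trans|].
  by move=> i j; exists (maxn i j); rewrite leq_maxl leq_maxr.
have cau : order_cauchy (fun m n => (m <= n)%N : Prop) x.
  exists {e : R | 0 < e}, (fun e e' : {e : R | 0 < e} => sval e' <= sval e),
    (fun e : {e : R | 0 < e} => rc (sval e)); split; last first.
    move=> [e e0] /=; have [N hN] := hx e e0; exists (N, N) => -[m n] [/= Nm Nn].
    exact: hN.
  split=> [|[e e0] [e' e0'] /= /cle_rc //|].
    split; first exact: (inhabits (exist _ 1 ltr01)).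
    - by move=> e /=.
    - by move=> e1 e2 e3 h1 h2; exact: le_trans h2 h1.
    - move=> [e e0] [e' e0'] /=.
      have h : 0 < Num.min e e' by rewrite lt_min e0.
      by exists (exist (fun e : R => 0 < e : Prop) _ h); rewrite /= !ge_min !lexx orbT.
  split=> [_ [[e e0] _ <-]|b hb]; first exact/cle0_rc/ltW.
  have hb' e : 0 < e -> cle b (rc e) by move=> e0; apply: hb; exists (exist _ e e0).
  apply: cle_eps; [exact: cle_sal (sa_rc _) (hb' 1 ltr01)|exact: sa0|].
  by move=> e e0; rewrite add0r; exact: hb'.
have [l [J [leJ [g [[_ _ [g0 ginf]] hl]]]]] := order_complete _ _ _ dir cau.
exists l => e e0; have [N hN] := hx e e0; exists N => n Nn.
(* For fixed [n], [lnorm (x n - l) - rc e] lies below every [g j], hence below their infimum 0. *)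
apply/cle_sub; rewrite -oppr0 -opprB; apply: cleN.
apply: ginf => _ [j _ <-]; have [i0 hi0] := hl j.
have h1 := hN n (maxn i0 N) Nn (leq_maxr _ _).
have h2 := hi0 (maxn i0 N) (leq_maxl _ _).
have /cle_sub h3 := cle_trans (lnorm_triangle (x (maxn i0 N)) _ _) (cleD h1 h2).
by apply/cle_sub; move: h3; congr cle; ring.
Qed.

End KaplanskyBanach.

(** * First occurrences in sequences of idempotents *)

Section FirstOccurrence.
Context {R : realType} {A : stoneAlgType R}.
Implicit Types (p q r : A) (f : nat -> A).

(** The complement of the join of all [f m] with [m < n]; hence [first f n] is the part where [f]
    occurs for the first time at [n]. *)
Definition unmet f n : A := \prod_(m < n) (1 - f m).
Definition first f n := unmet f n * f n.

(** For idempotents: the upper limit of [f] is 1. *)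
Definition frequent f := forall N r, idem r ->
  (forall n, (N <= n)%N -> r * f n = 0) -> r = 0.

Lemma unmetS f n : unmet f n.+1 = unmet f n * (1 - f n).
Proof. by rewrite /unmet big_ord_recr. Qed.

Variable f : nat -> A.
Hypothesis idf : forall n, idem (f n).

Lemma idem_unmet n : idem (unmet f n).
Proof.
elim: n => [|n IH]; first by rewrite /unmet big_ord0; exact: idem1.
by rewrite unmetS; apply/idemM/idemC.
Qed.

Lemma idem_first n : idem (first f n).
Proof. exact/idemM/idf/idem_unmet. Qed.

Lemma unmet_mul m n : (m <= n)%N -> unmet f n * unmet f m = unmet f n.
Proof.
move=> /subnK <-; elim: (n - m)%N => [|k IH]; first exact: idem_unmet.
by rewrite addSn unmetS mulrAC IH.
Qed.

Lemma unmet_first m n : (m < n)%N -> unmet f n * first f m = 0.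
Proof.
move=> /unmet_mul <-; rewrite unmetS /first.
transitivity (unmet f n * unmet f m * unmet f m * (f m * (1 - f m))); first by ring.
by rewrite idem_mulC // mulr0.
Qed.

Lemma first_unmet m n : (n <= m)%N -> first f m * (1 - unmet f n) = 0.
Proof.
move=> /unmet_mul h; rewrite /first mulrAC mulrBr mulr1 h subrr mul0r //.
Qed.

Lemma first_disjoint m n : m <> n -> first f m * first f n = 0.
Proof.
wlog mn : m n / (m < n)%N => [h ne|_].
  have [mn|nm|//] := ltngtP m n; first exact: h.
  by rewrite mulrC; apply: h => //; exact: nesym.
by rewrite mulrC {1}/first mulrAC unmet_first // mul0r.
Qed.

Lemma first_partition : covering f -> partition_of_unity (first f).
Proof.
move=> cf; apply/partition_of_unityP; split.
- exact: idem_first.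
- exact: first_disjoint.
- move=> r ir hr; apply: cf => // n.
  have h k : r * unmet f k = r.
    elim: k => [|k IH]; first by rewrite /unmet big_ord0 mulr1.
    by rewrite unmetS mulrA mulrBr mulr1 {1}IH -mulrA hr subr0.
  by rewrite -(h n) -mulrA hr.
Qed.

End FirstOccurrence.

(** * The hull defined by a covering condition, and its cluster points *)

Section TotallyBoundedHull.
Context {R : realType} {A : stoneAlgType R} {E : kaplanskyBanachModType A}.
Implicit Types (a b c p q r : A) (e : R) (x y z : E).

(* On no nonzero idempotent is x at distance at least a from all of L. *)
Definition near_seq (L : seq E) a x := forall r, idem r ->
  (forall y, y \in L -> cle (r * a) (r * lnorm (x - y))) -> r = 0.

(** An [r] violating the condition would put [r (u i + e)] below the infimum of the distances, hence
    below [u i]; the summand [e] then forces [r = 0]. *)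
Lemma totally_order_bounded_near (M : set E) : totally_order_bounded M ->
  exists (I : Type) (le : I -> I -> Prop) (u : I -> A) (L : I -> seq E),
    decreasing_to0 le u /\
    forall i x e, M x -> 0 < e -> near_seq (L i) (u i + rc e) x.
Proof.
move=> [I [le [u [du hu]]]].
have [L hL] : exists L : I -> seq E, forall i x, M x ->
    exists g, is_inf [set lnorm (x - y) | y in [set` L i]] g /\ cle g (u i).
  have hu' i : exists l : seq E, forall x, M x ->
      exists g, is_inf [set lnorm (x - y) | y in [set` l]] g /\ cle g (u i).
    by have [F [/finite_seqP [l ->] h]] := hu i; exists l.
  by have [L hL] := choice hu'; exists L.
exists I, le, u, L; split=> // i x e Mx e0 r ir hr.
have [g [[_ ginf] gu]] := hL i x Mx.
have h : cle (r * (u i + rc e)) (u i).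
  apply: cle_trans gu; apply: ginf => _ [y /= yL <-].
  apply: cle_trans (hr y yL) _.
  by have := cleM2l (lnorm_ge0 (x - y)) (idem_le1 ir); rewrite mulr1 mulrC.
apply: (idem_rc_eq0 e0 ir).
have /cle_subr_ge0 hh := cleMp ir h; apply/cle_sub.
move: hh; rewrite mulrA ir !rmorph0; congr cle; ring.
Qed.

Variables (I : Type) (u : I -> A) (L : I -> seq E).

Definition hull : set E :=
  [set x | forall i e, 0 < e -> near_seq (L i) (u i + rc e) x].

Lemma hull_mixing (J : Type) (p : J -> A) (x : J -> E) y :
  partition_of_unity p -> (forall j, hull (x j)) -> is_mixing p x y -> hull y.
Proof.
move=> /partition_of_unityP [ip _ cp] hx /(is_mixingP _ _ ip) hy i e e0 r ir hr.
apply: cp => // j; apply: (hx j i e e0) => [|z zL]; first exact: idemM.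
have := cleMp (ip j) (hr z zL).
rewrite (mulrC r (p j)) -!mulrA (mulrCA (p j) r (lnorm _)).
by rewrite (lnorm_sub_on _ (ip j) (hy j)) (mulrCA (p j) r (lnorm (x j - z))).
Qed.

Lemma hull_closed (x : nat -> E) l :
  (forall n, hull (x n)) -> norm_limit x l -> hull l.
Proof.
move=> hx xl i e e0 r ir hr; have e2 : 0 < e / 2 by lra.
have [N /(_ N (leqnn N)) hN] := xl _ e2.
apply: (hx N i _ e2) => // y yL.
have /cle_subr_ge0 h1 := cleMp ir (lnorm_triangle (x N) l y).
have /cle_subr_ge0 h2 := hr y yL.
have /cle_subr_ge0 h3 := cleMp ir hN.
apply/cle_sub; have := cle0D (cle0D h1 h2) h3; congr cle.
rewrite (lnormBC l) (rc_half e); ring.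
Qed.

Hypothesis u_ge0 : forall i, cle 0 (u i).
Hypothesis u_inf : forall b, (forall i, cle b (u i)) -> cle b 0.

(** Where [x] is at least [C], each point of [L i], being of norm at most [B], is at distance at
    least [u i + 1], which [near_seq] excludes. *)
Lemma hull_bounded : I ->
  exists2 C, 0 <= C & forall x, hull x -> cle (lnorm x) (rc C).
Proof.
move=> i.
have [B B0 hB] : exists2 B, 0 <= B & forall y, y \in L i -> enorm y <= B.
  elim: (L i) => [|y l [B B0 hB]]; first by exists 0.
  have y0 : 0 <= enorm y by exact: cnorm_ge0.
  exists (B + enorm y) => [|z]; first exact: addr_ge0.
  by rewrite inE => /orP[/eqP ->|/hB]; lra.
pose C := B + cnorm (u i) + 1.
exists C => [|x hx]; first by have := cnorm_ge0 (u i); rewrite /C; lra.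
apply: cle_forcing; [exact: sa_lnorm|exact: sa_rc|move=> r ir hr].
apply: (hx i 1 ltr01) => // y yL.
have /cle_subr_ge0 h1 := cleMp ir (lnorm_le_add x y).
have h2 := cle_trans (cle_enorm y) (cle_rc (hB y yL)).
have /cle_subr_ge0 h3 := cleMp ir (cleD h2 (cle_norm (cle0_sa (u_ge0 i)))).
have /cle_subr_ge0 h4 := hr.
apply/cle_sub; have := cle0D (cle0D h1 h3) h4; congr cle.
rewrite /C !rmorphD; ring.
Qed.

Lemma hull_mix_complete : I -> mix_complete hull.
Proof.
move=> i J p x pu hx; have [C C0 hC] := hull_bounded i.
have [ip _ _] := (partition_of_unityP _).1 pu.
have [|y hy] := @exists_mixing _ _ E _ p x _ pu _ (cle0_rc C0).
  move=> j; apply: cle_trans (hC _ (hx j)).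
  by have := cleM2l (lnorm_ge0 (x j)) (idem_le1 (ip j)); rewrite mulr1 mulrC.
by exists y; split=> //; exact: hull_mixing hy.
Qed.

Variable s : nat -> E.
Hypothesis hs : forall n, hull (s n).

(** The Boolean-valued form, on every part of [r], of the assertion that [s] returns infinitely
    often along [f] to the [e]-ball around [y]. *)
Definition clusters (f : nat -> A) e y r := forall N q, idem q ->
  (forall n, (N <= n)%N ->
     cle (q * r * f n * rc e) (q * r * f n * lnorm (s n - y))) -> q * r = 0.

(* Pigeonhole: otherwise one could avoid the finitely many points of L i one
   after the other on smaller and smaller idempotents. *)
Lemma exists_cluster f e r : (forall n, idem (f n)) -> frequent f -> 0 < e ->
  idem r -> r <> 0 ->
  exists q y, [/\ idem q, q <> 0, q * r = q & clusters f e y q].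
Proof.
move=> idf ff e0 ir r0; have e2 : 0 < e / 2 by lra.
(* As [u] has infimum 0, some [u i] is not above [e / 2] on all of [r]; [q0] will be a nonzero part
   of [r] where [u i] is at most [e / 2]. *)
have [i hi] : exists i, ~ cle (r * rc (e / 2)) (r * u i).
  apply: contrapT => /forallNP h; apply: r0; apply: (idem_rc_eq0 e2 ir).
  rewrite !rmorph0 mulr0; apply: u_inf => i.
  have := h i; rewrite notK => /cle_trans; apply.
  by have := cleM2l (u_ge0 i) (idem_le1 ir); rewrite mulr1 mulrC.
have [p [ip h1 h2]] := comparison (cle0_sa (u_ge0 i)) (sa_rc (e / 2)).
pose q0 := r * (1 - p).
have iq0 : idem q0 by apply/idemM/idemC.
have q00 : q0 <> 0.
  move=> q0E; apply: hi.
  have rp : r = r * p by apply/subr0_eq; rewrite -q0E /q0; ring.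
  by rewrite rp -!mulrA; exact: cleMp.
have q0u : cle (q0 * u i) (q0 * rc (e / 2)).
  by rewrite /q0 -!mulrA; exact: cleMp.
apply: contrapT => no.
(* If [y] is no cluster point on [q], then on a smaller nonzero idempotent and from a later index
   on, [s] stays away from [y] too. *)
have avoid (l : seq E) : exists q N, [/\ idem q, q <> 0, q * q0 = q &
    forall n y, (N <= n)%N -> y \in l ->
      cle (q * f n * rc e) (q * f n * lnorm (s n - y))].
  elim: l => [|y l [q [N [iq qn0 qq0 hq]]]]; first by exists q0, 0%N.
  have : ~ clusters f e y q.
    move=> hc; apply: no; exists q, y; split=> //.
    by rewrite -qq0 /q0; rewrite -!mulrA (mulrC _ r) (mulrA r r) ir.
  move=> /existsNP [N' /existsNP [q' /not_implyP [iq' /not_implyP [hq' q'0]]]].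
  exists (q' * q), (maxn N N'); split=> //; first exact: idemM.
    by rewrite -mulrA qq0.
  move=> n z; rewrite geq_max => /andP[Nn N'n].
  rewrite inE => /orP[/eqP ->|zl]; first exact: hq'.
  by have := cleMp iq' (hq n z Nn zl); rewrite !mulrA.
have [q [N [iq qn0 qq0 hq]]] := avoid (L i).
apply: qn0; apply: (ff N) => // n Nn.
have iqf := idemM iq (idf n).
(* On [q * f n] the point [s n] is at distance at least [e] from all of [L i], while [u i + e / 2]
   is at most [e] there; so [q * f n = 0] for all [n] from [N] on. *)
apply: (@hs n i (e / 2) e2 (q * f n) iqf) => y yL; apply: cle_trans (hq n y Nn yL).
have /(cleMp iqf)/cle_subr_ge0 hu := q0u.
apply/cle_sub; move: hu; congr cle.
have qE a : q * f n * (q0 * a) = q * f n * a.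
  by rewrite -[in RHS]qq0; ring.
rewrite !qE (rc_half e); ring.
Qed.

Lemma exists_global_cluster f e :
  I -> (forall n, idem (f n)) -> frequent f -> 0 < e ->
  exists y, clusters f e y 1.
Proof.
move=> i idf ff e0; have [C C0 hC] := hull_bounded i.
pose D := [set r | idem r /\ exists y, clusters f e y r].
have [||J [p [pu hp]]] := @exhaustion _ _ D; first by move=> p [].
  move=> r ir r0; have [q [y [iq q0 qr hc]]] := exists_cluster idf ff e0 ir r0.
  by exists q; split=> //; split=> //; exists y.
have [ip _ cp] := (partition_of_unityP _).1 pu.
have [y hy] := choice (fun j => (hp j).2).
have Ce : 0 <= C + e by lra.
have [|z /(is_mixingP _ _ ip) hz] := @exists_mixing _ _ E _ p y _ pu _ (cle0_rc Ce).
  (* Mixing needs a common bound. On a part of [p j] where [y j] is at least [C + e], every [s n],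
     being bounded by [C], would be [e]-far from [y j]. *)
  move=> j; have [r [ir h1 h2]] := comparison (sa_lnorm (y j)) (sa_rc (C + e)).
  have rp : r * p j = 0.
    apply: (hy j 0%N) => // n _; have iw := idemM (idemM ir (ip j)) (idf n).
    have /(cleMp (idemM (ip j) (idf n)))/cle_subr_ge0 g1 := h1.
    have /(cleMp iw)/cle_subr_ge0 g2 := hC _ (@hs n).
    have /(cleMp iw)/cle_subr_ge0 g3 := lnorm_le_add (y j) (s n).
    apply/cle_sub; have := cle0D (cle0D g1 g2) g3; congr cle.
    by rewrite (lnormBC (y j)) rmorphD rmorphD; ring.
  have pr : p j = p j * (1 - r) by rewrite mulrBr mulr1 mulrC rp subr0.
  rewrite pr -mulrA; apply: cle_trans (cleMp (ip j) h2) _.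
  rewrite mulrA -pr.
  by have := cleM2l (cle0_rc Ce) (idem_le1 (ip j)); rewrite mulr1 mulrC.
exists z => N q iq hq; rewrite mulr1; apply: cp => // j.
apply: (hy j N) => // n Nn.
have /(cleMp (ip j)) := hq n Nn.
have -> a : p j * (q * 1 * f n * a) = q * f n * (p j * a) by ring.
have -> a : p j * (q * 1 * f n * a) = q * f n * (p j * a) by ring.
rewrite (lnormBC _ z) (lnorm_sub_on _ (ip j) (hz j)) (lnormBC _ (s n)).
by congr cle; ring.
Qed.

(** Each [f n] is cut down to a part where [s n] is within [e] of a global cluster point; the
    cluster property keeps the result frequent. *)
Lemma refine f e : I -> (forall n, idem (f n)) -> frequent f -> 0 < e ->
  exists (g : nat -> A) y, [/\ forall n, idem (g n), frequent g,
    forall n, g n * f n = g n &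
    forall n, cle (g n * lnorm (s n - y)) (g n * rc e)].
Proof.
move=> i idf ff e0; have [y hy] := exists_global_cluster i idf ff e0.
have [r hr] := choice (fun n => comparison (sa_lnorm (s n - y)) (sa_rc e)).
have ir n : idem (r n) by have [] := hr n.
exists (fun n => f n * (1 - r n)), y; split=> [n|N q iq hq|n|n].
- exact/idemM/idemC.
- rewrite -[q]mulr1; apply: (hy N) => // n Nn; rewrite mulr1.
  have -> : q * f n = q * f n * r n.
    by apply/subr0_eq; rewrite -[RHS](hq n Nn); ring.
  by rewrite -!mulrA; apply/cleMp => //; apply/cleMp => //; have [] := hr n.
- by rewrite mulrAC idf.
- by rewrite -!mulrA; apply/cleMp => //; have [] := hr n.
Qed.

End TotallyBoundedHull.

(** * Convergent cyclic subsequences in the hull *)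

Section CyclicCompactness.
Context {R : realType} {A : stoneAlgType R} {E : kaplanskyBanachModType A}.
Implicit Types (a b c p q r : A) (e : R) (x y z : E).

Lemma inv_nat_lt e : 0 < e -> exists j, j.+1%:R^-1 + j.+1%:R^-1 < e :> R.
Proof.
move=> e0; have e2 : 0 < e / 2 by lra.
have [j] := ltr_add_invr e2; rewrite add0r => hj.
by exists j; rewrite [e in _ < e]splitr; exact: ltrD.
Qed.

Lemma inv_nat_gt0 j : 0 < j.+1%:R^-1 :> R.
Proof. by rewrite invr_gt0. Qed.

Section Subsequence.
Variables (I : Type) (u : I -> A) (L : I -> seq E) (i0 : I).
Hypothesis u_ge0 : forall i, cle 0 (u i).
Hypothesis u_inf : forall b, (forall i, cle b (u i)) -> cle b 0.
Variable s : nat -> E.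
Hypothesis hs : forall n, hull u L (s n).

Lemma nested_clusters : exists (f : nat -> nat -> A) (y : nat -> E),
  [/\ forall j n, idem (f j n), forall j, frequent (f j),
    forall j k n, (j <= k)%N -> f k n * f j n = f k n &
    forall j n, cle (f j n * lnorm (s n - y j)) (f j n * rc j.+1%:R^-1)].
Proof.
(* Packaging a sequence with its invariants lets a single choice function [g] be iterated over all
   levels. *)
pose S := {f : nat -> A | (forall n, idem (f n)) /\ frequent f}.
have [g hg] : exists g : nat * S -> S * E, forall w,
    (forall n, sval (g w).1 n * sval w.2 n = sval (g w).1 n) /\
    (forall n, cle (sval (g w).1 n * lnorm (s n - (g w).2))
                   (sval (g w).1 n * rc w.1.+1%:R^-1)).
  suff /choice [g hg] : forall w : nat * S, exists v : S * E,
    (forall n, sval v.1 n * sval w.2 n = sval v.1 n) /\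
    (forall n, cle (sval v.1 n * lnorm (s n - v.2))
                   (sval v.1 n * rc w.1.+1%:R^-1)) by exists g.
  move=> [j [f [idf ff]]].
  have [h [y [idh fh hf hy]]] :=
    refine u_ge0 u_inf hs i0 idf ff (inv_nat_gt0 j).
  by exists (exist _ h (conj idh fh), y).
have h1 : (forall n : nat, idem (1 : A)) /\ frequent (fun _ : nat => 1 : A).
  split=> [_|N r ir /(_ N (leqnn N))]; first exact: idem1.
  by rewrite mulr1.
pose st := fix st j : S := if j is k.+1 then (g (k, st k)).1 else exist _ _ h1.
(* The shift makes family [j] the one already refined at scale [1 / (j + 1)]; stage 0 is constantly
   1. *)
exists (fun j => sval (st j.+1)), (fun j => (g (j, st j)).2).
have idst j n : idem (sval (st j) n) by case: (st j) => f [].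
split=> // [j|j k n|j n].
- by case: (st j.+1) => f [].
- move=> /subnK <-; elim: (k - j)%N => [|m IH]; first exact: idst.
  rewrite addSn; have [<- _] := hg ((m + j).+1, st (m + j).+1).
  by rewrite -mulrA IH.
- by have [_] := hg (j, st j).
Qed.

Lemma hull_subsequence :
  exists t y, [/\ cyclic_subsequence s t, hull u L y & norm_cvg t y].
Proof.
have [f [y [idf ff fM hy]]] := nested_clusters.
pose psi := fix psi k : nat -> A := if k is k'.+1
  then fun n => f k n * (1 - unmet (psi k') n) else f 0%N.
pose nu k := first (psi k).
have idpsi k n : idem (psi k n).
  elim: k n => [|k IH] n //=.
  by apply/idemM => //; apply/idemC/idem_unmet.
have psif k n : psi k n * f k n = psi k n.
  by case: k => [|k] /=; [exact: idf|rewrite mulrAC idf].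
have nuf j k n : (j <= k)%N -> nu k n * f j n = nu k n.
  by move=> jk; rewrite /nu /first -psif -!mulrA fM.
have pnu k : partition_of_unity (nu k).
  apply: first_partition => //.
  elim: k => [r ir hr|k IH]; first exact: (ff 0%N 0%N r ir (fun n _ => hr n)).
  (* Where [psi k] first occurs at [m], [psi k.+1 n] agrees with [f k.+1 n] for all [n > m], and a
     tail of the frequent [f k.+1] still covers. *)
  move=> r ir hr; have /partition_of_unityP [_ _ cnu] := first_partition (idpsi k) IH.
  apply: cnu => // m; have iw := idemM ir (idem_first (idpsi k) m).
  apply: (ff k.+1 m.+1) => // n mn.
  rewrite -[RHS](mulr0 (first (psi k) m)) -(hr n) /=.
  have e := unmet_first (idpsi k) mn.
  transitivity (r * f k.+1 n * (first (psi k) m - unmet (psi k) n * first (psi k) m)).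
    by rewrite e; ring.
  by ring.
have [t ht] : exists t, forall k, hull u L (t k) /\ is_mixing (nu k) s (t k).
  have h k : exists z, hull u L z /\ is_mixing (nu k) s z.
    exact: (@hull_mix_complete R A E I u L u_ge0 i0 nat (nu k) s (pnu k) hs).
  by have [t ht] := choice h; exists t.
(* On [nu k n] the point [t k] is [s n], and [nu k n] lies below [f j n] because the families are
   nested. *)
have ty j k : (j <= k)%N -> cle (lnorm (t k - y j)) (rc j.+1%:R^-1).
  move=> jk; have /partition_of_unityP [inu _ cnu] := pnu k.
  apply: (covering_cle (sa_lnorm _) (sa_rc _) cnu) => // n.
  have /(is_mixingP _ _ inu) /(_ n) mt := (ht k).2.
  rewrite (lnorm_sub_on _ (inu n) mt).
  by have := cleMp (inu n) (hy j n); rewrite !(mulrA (nu k n)) nuf.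
have [l tl] : exists l, norm_limit t l.
  apply: norm_complete => e /inv_nat_lt [j hj]; exists j => m n jm jn.
  apply: cle_trans (lnorm_triangle (y j) _ _) _.
  rewrite (lnormBC (y j)); apply: cle_trans (cleD (ty _ _ jm) (ty _ _ jn)) _.
  by rewrite -!rmorphD; apply/cle_rc/ltW.
exists t, l; split; last exact/norm_cvgP.
- exists nu; split=> [//|k m n|k]; last by have [] := ht k.
  (* If [n <= m], a first occurrence of [psi k] at [m] rules out any occurrence before [n], whereas
     [psi k.+1 n] requires one. *)
  apply: contraNT; rewrite -leqNgt => nm.
  have e := first_unmet (idpsi k) nm.
  rewrite /nu {2}/first /=.
  transitivity (first (psi k) m * (1 - unmet (psi k) n) *
     (unmet (psi k.+1) n * f k.+1 n) == 0); last by rewrite e mul0r eqxx.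
  by congr (_ == _); rewrite /=; ring.
- by apply: hull_closed tl => k; have [] := ht k.
Qed.

End Subsequence.

(** * The two implications *)

Lemma totally_order_bounded_relatively_cyclically_compact (M : set E) :
  totally_order_bounded M ->
  norm_bounded M /\ relatively_cyclically_compact (mix M).
Proof.
move=> /totally_order_bounded_near [I [le [u [L [[dir _ [u0 uinf]] hM]]]]].
have [[i0] _ _ _] := dir.
have u_ge0 i : cle 0 (u i) by apply: u0; exists i.
have u_inf b : (forall i, cle b (u i)) -> cle b 0.
  by move=> hb; apply: uinf => _ [i _ <-].
have MK x : M x -> hull u L x by move=> Mx i e e0; exact: hM.
split.
  have [C C0 hC] := @hull_bounded R A E I u L u_ge0 i0.
  by apply/norm_boundedP; exists C => // x /MK /hC.
exists (hull u L); split.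
  split; first exact: @hull_mix_complete R A E I u L u_ge0 i0.
  by move=> s hs; exact: hull_subsequence.
move=> x [p [pu px]]; apply: hull_mixing pu _ px => m.
by apply: MK; exact: set_valP.
Qed.

(* Exhaustion makes the local failure of total boundedness global, so every
   finite set can be extended by a point of K at distance d on r. *)
Lemma separated_extension (K : set E) (M : set E) r d (F : seq E) :
  mix_complete K -> M `<=` K -> M !=set0 -> idem r ->
  (forall q, idem q -> q <> 0 -> q * r = q -> exists x q', [/\ M x, idem q',
     q' <> 0, q' * q = q' & forall y, y \in F ->
       cle (q' * rc d) (q' * lnorm (x - y))]) ->
  exists x, K x /\ forall y, y \in F -> cle (r * rc d) (r * lnorm (x - y)).
Proof.
move=> Kmix MK [x0 Mx0] ir hr.
pose D := [set q : A | idem q /\ exists x, M x /\ forall y, y \in F ->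
  cle (q * r * rc d) (q * r * lnorm (x - y))].
have [||J [p [pu hp]]] := @exhaustion _ _ D; first by move=> q [].
  (* On an idempotent disjoint from [r] nothing has to be separated, and [x0] serves as default. *)
  move=> q iq q0; have [e|ne] := pselect (q * r = 0).
    exists q; split=> //; split=> //; exists x0; split=> // y _.
    by rewrite e !mul0r; exact: cle_refl.
  have [|x [q' [Mx iq' q'0 q'q hx]]] := hr (q * r) (idemM iq ir) ne.
    by rewrite -mulrA ir.
  have q'r : q' * r = q' by rewrite -q'q -!mulrA ir.
  exists q'; split=> //; last first.
    by rewrite -{1}q'q -!mulrA (mulrC r) (mulrA q q) iq q'q.
  by split=> //; exists x; split=> // y yF; rewrite q'r; exact: hx.
have [ip _ cp] := (partition_of_unityP _).1 pu.
have [x hx] := choice (fun j => (hp j).2).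
have [|z [Kz /(is_mixingP _ _ ip) hz]] := Kmix _ p x pu.
  by move=> j; apply: MK; have [] := hx j.
exists z; split=> // y yF.
have ir0 := idem_ge0 ir.
apply: (covering_cle _ _ cp) => // [||j].
- exact/saM/sa_rc/cle0_sa.
- exact/saM/sa_lnorm/cle0_sa.
have := (hx j).2 y yF.
rewrite (mulrCA (p j) r (lnorm _)) (lnorm_sub_on _ (ip j) (hz j)).
by congr cle; ring.
Qed.

(** Recursion yields a sequence [d]-separated on [r]. Consecutive terms of a cyclic subsequence mix
    terms of different index, so they stay [d] apart on [r], against convergence unless [r = 0]. *)
Lemma cyclically_compact_not_separated (K : set E) r d :
  cyclically_compact K -> idem r -> 0 < d ->
  (forall F : seq E, exists x, K x /\
     forall y, y \in F -> cle (r * rc d) (r * lnorm (x - y))) ->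
  r = 0.
Proof.
move=> [_ Kc] ir d0 /choice [g hg].
(* [hist n] collects all [s m] with [m < n], so each new point is separated from every earlier
   one. *)
pose hist := fix hist n : seq E := if n is m.+1 then g (hist m) :: hist m else [::].
pose s n := g (hist n).
have hist_mem m n : (m < n)%N -> s m \in hist n.
  elim: n => [//|n IH]; rewrite ltnS leq_eqVlt => /orP[/eqP ->|/IH h] /=.
    by rewrite mem_head.
  by rewrite in_cons h orbT.
have sep m n : (m < n)%N -> cle (r * rc d) (r * lnorm (s n - s m)).
  by move=> /hist_mem; have [_] := hg (hist n); apply.
have [|t [y [[nu [pnu llnu tnu]] _ /norm_cvgP ty]]] := Kc s.
  by move=> n; have [] := hg (hist n).
have sa_r : sa r := idem_sa ir.
have far k : cle (r * rc d) (r * lnorm (t k - t k.+1)).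
  have [i1 _ c1] := (partition_of_unityP _).1 (pnu k).
  have [i2 _ c2] := (partition_of_unityP _).1 (pnu k.+1).
  have /(is_mixingP _ _ i1) t1 := tnu k.
  have /(is_mixingP _ _ i2) t2 := tnu k.+1.
  have sa1 : sa (r * rc d) by apply: saM => //; exact: sa_rc.
  have sa2 : sa (r * lnorm (t k - t k.+1)) by apply: saM => //; exact: sa_lnorm.
  have sai m : sa (nu k m) := idem_sa (i1 m).
  apply: (covering_cle sa1 sa2 c1) => // m.
  apply: (covering_cle (saM (sai m) sa1) (saM (sai m) sa2) c2) => // n.
  (* On a nonzero product, [t k] is [s m] and [t k.+1] is [s n] with [m < n]. *)
  have [e|/llnu mn] := eqVneq (nu k m * nu k.+1 n) 0.
    by rewrite !(mulrA (nu k.+1 n)) (mulrC (nu k.+1 n)) e !mul0r; exact: cle_refl.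
  rewrite (mulrCA (nu k m) r (lnorm _)) (lnorm_sub_on _ (i1 m) (t1 m)).
  rewrite (mulrCA r (nu k m) (lnorm _)) (mulrCA (nu k.+1 n) (nu k m) (_ * lnorm _)).
  rewrite (mulrCA (nu k.+1 n) r (lnorm _)) lnormBC (lnorm_sub_on _ (i2 n) (t2 n)).
  rewrite (mulrCA r (nu k.+1 n) (lnorm _)) (mulrCA (nu k m) (nu k.+1 n) (_ * lnorm _)).
  by apply/cleMp/cleMp/sep.
have d4 : 0 < d / 4 by lra.
have [N hN] := ty _ d4.
have h1 := hN N (leqnn N); have h2 := hN N.+1 (leqnSn N).
rewrite lnormBC in h2.
apply: (@idem_rc_eq0 _ _ r d (d / 4 + d / 4)) => //; first by lra.
apply: cle_trans (far N) _; apply: cleMp => //.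
rewrite !rmorphD.
exact: cle_trans (lnorm_triangle y _ _) (cleD h1 h2).
Qed.

Lemma sub_mix (M : set E) : M `<=` mix M.
Proof.
move=> x Mx; pose p (m : M) : A := if pselect (val m = x) then 1 else 0.
have px m : val m = x -> p m = 1 by rewrite /p; case: pselect.
have pN m : val m <> x -> p m = 0 by rewrite /p; case: pselect.
have [m0 hm0] : exists m : M, val m = x by exists (SigSub (mem_set Mx)).
exists p; split; last first.
  move=> m; have [e|/pN ->] := pselect (val m = x); last by rewrite mul0r.
  by rewrite e subrr lnorm0 mulr0.
apply/partition_of_unityP; split=> [m|m m' ne|r ir hr].
- by have [/px ->|/pN ->] := pselect (val m = x); [exact: idem1|exact: idem0].
- have [e|/pN ->] := pselect (val m = x); last by rewrite mul0r.
  rewrite (pN m') ?mulr0 // => e'; apply: ne; apply: val_inj.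
  by rewrite e e'.
- by have := hr m0; rewrite px // mulr1.
Qed.

(** The net consists of all admissible bounds and is directed by uniting the finite sets. If a lower
    bound were at least [d] on some nonzero [r], then [K] would contain [d / 2]-separated points on
    [r]. *)
Lemma relatively_cyclically_compact_totally_order_bounded (M : set E) :
  norm_bounded M -> relatively_cyclically_compact (mix M) ->
  totally_order_bounded M.
Proof.
move=> /norm_boundedP [C C0 hC] [K [Kc mK]].
have MK : M `<=` K by move=> x /sub_mix /mK.
(* Adjoining 0 makes the set nonempty and keeps the infimum below [lnorm x], hence below [C] on
   [M]. *)
pose dist x (F : seq E) : set A := [set lnorm (x - y) | y in [set` 0 :: F]].
have dist_inf x F : exists g, is_inf (dist x F) g.
  apply: exists_inf => [|_ [y _ <-]]; last exact: lnorm_ge0.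
  by exists (lnorm (x - 0)), 0 => //=; rewrite mem_head.
have dist_le x (F : seq E) g y : is_inf (dist x F) g -> y \in 0 :: F ->
    cle g (lnorm (x - y)).
  by move=> [h _] yF; apply: h; exists y.
have dist_leC x F g : M x -> is_inf (dist x F) g -> cle g (rc C).
  move=> Mx h; apply: cle_trans (hC x Mx).
  by rewrite -[x in cle _ (lnorm x)]subr0; apply: dist_le h _; exact: mem_head.
have dist_sa x F g : is_inf (dist x F) g -> sa g.
  move=> h; apply: cle_sal (sa_lnorm (x - 0)) (dist_le _ _ _ _ h _).
  exact: mem_head.
pose adm (v : A) := cle 0 v /\ exists F : seq E, forall x, M x ->
  exists g, is_inf (dist x F) g /\ cle g v.
have admC : adm (rc C).
  split; first exact: cle0_rc.
  exists [::] => x Mx; have [g hg] := dist_inf x [::].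
  by exists g; split=> //; exact: dist_leC hg.
exists {v : A | adm v}, (fun v w => cle (sval w) (sval v)), (fun v => sval v).
split; last first.
  move=> [v [v0 [F hF]]]; exists [set` 0 :: F]; split; first exact: finite_seq.
  exact: hF.
split=> //.
  split; first exact: (inhabits (exist _ _ admC)).
  - by move=> v; exact: cle_refl.
  - by move=> v1 v2 v3 h1 h2; exact: cle_trans h2 h1.
  - move=> [v [v0 [F hF]]] [w [w0 [G hG]]] /=.
    have [m [mv mw mmax]] := exists_min (cle0_sa v0) (cle0_sa w0).
    suff am : adm m by exists (exist _ m am).
    split; first exact: mmax.
    exists (F ++ G) => x Mx; have [g hg] := dist_inf x (F ++ G).
    exists g; split=> //; apply: mmax.
      have [gF [[_ hgF] gFv]] := hF x Mx; apply: cle_trans gFv.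
      apply: hgF => _ [y /= yF <-]; apply: dist_le hg _.
      by move: yF; rewrite !inE mem_cat => /orP[->|->]; rewrite ?orbT.
    have [gG [[_ hgG] gGw]] := hG x Mx; apply: cle_trans gGw.
    apply: hgG => _ [y /= yG <-]; apply: dist_le hg _.
    by move: yG; rewrite !inE mem_cat => /orP[->|->]; rewrite ?orbT.
split=> [_ [[v [v0 _]] _ <-] //|b hb].
have hb' v : adm v -> cle b v by move=> av; apply: hb; exists (exist _ v av).
have sab : sa b by apply: cle_sal (hb' _ admC); exact: sa_rc.
apply: cle_eps => // [|d d0]; first exact: sa0.
rewrite add0r; have [r [ir h1 h2]] := comparison sab (sa_rc d).
suff r0 : r = 0 by move: h2; rewrite r0 subr0 !mul1r.
apply: contrapT => r0; have d2 : 0 < d / 2 by lra.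
have local (F : seq E) q : idem q -> q <> 0 -> q * r = q ->
  exists x q', [/\ M x, idem q', q' <> 0, q' * q = q' & forall y, y \in F ->
       cle (q' * rc (d / 2)) (q' * lnorm (x - y))].
  move=> iq q0 qr; apply: contrapT => no; apply: q0.
  (* If no point of [M] were [d / 2]-far from [F] on a nonzero part of [q], this [v] would be
     admissible; then [b] would be at most [d / 2] on [q], where it is at least [d]. *)
  pose v := q * rc (d / 2) + (1 - q) * rc C.
  have qv : q * v = q * rc (d / 2).
    by rewrite mulrDr !mulrA iq idem_mulC // mul0r addr0.
  have qv' : (1 - q) * v = (1 - q) * rc C.
    by rewrite mulrDr !mulrA (idemC iq) (mulrC _ q) idem_mulC // mul0r add0r.
  have /hb' bv : adm v.
    split.
      apply: cle0D; apply: cle0M; [exact: idem_ge0|exact/cle0_rc/ltW| |exact: cle0_rc].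
      exact/idem_ge0/idemC.
    exists F => x Mx; have [g hg] := dist_inf x F; exists g; split=> //.
    apply: (cle_split iq); last first.
      by rewrite qv'; apply: cleMp; [exact: idemC|exact: dist_leC hg].
    have [p [ip g1 g2]] := comparison (dist_sa _ _ _ hg) (sa_rc (d / 2)).
    have qp : q * p = 0.
      apply: contrapT => qp0; apply: no; exists x, (q * p); split=> //.
      - exact: idemM.
      - by rewrite mulrAC iq.
      - move=> y yF; apply: (@cle_trans _ _ (q * p * g)).
          by rewrite -!mulrA; exact: cleMp.
        apply: cleMp; first exact: idemM.
        by apply: dist_le hg _; rewrite in_cons yF orbT.
    have qE : q = q * (1 - p) by rewrite mulrBr qp mulr1 subr0.
    by rewrite qv qE -!mulrA; exact: cleMp.
  apply: (@idem_rc_eq0 _ _ q d (d / 2)) => //; first by lra.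
  rewrite -qv; apply: cle_trans (cleMp iq bv).
  by rewrite -qr -!mulrA; exact: cleMp.
(* The empty list serves only to produce a point of [M]. *)
have [x [_ [Mx _ _ _ _]]] := local [::] r ir r0 ir.
apply: r0; apply: (cyclically_compact_not_separated Kc ir d2) => F.
apply: (separated_extension (proj1 Kc) MK _ ir); first by exists x.
exact: local.
Qed.

End CyclicCompactness.

Theorem proposition4p5 (R : realType) (A : stoneAlgType R)
    (E : kaplanskyBanachModType A) (M : set E) :
  totally_order_bounded M <->
  (norm_bounded M /\ relatively_cyclically_compact (mix M)).
Proof.
split; first exact: totally_order_bounded_relatively_cyclically_compact.
by move=> [? ?]; exact: relatively_cyclically_compact_totally_order_bounded.
Qed.
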